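(* Let $\varphi:\mathbb{Z}^m\times\mathbb{Z}^m\to\mathbb{Z}^n$ be a full, alternating, bilinear map and let $G_\varphi$ be the associated two-step nilpotent group. Then $\mathrm{RF}_{G_\varphi}\preceq\log^{d(\varphi^{\mathbb{C}})+1}$.
   Context: Residual finiteness growth: let $G$ be a finitely generated residually finite group with finite generating set $S$, neutral element $e$, and word norm $\|\cdot\|_S$; put $B_S(r)=\{g\in G\mid \|g\|_S\le r\}$. Let $D_G(g)=\min\{[G:N]\mid g\notin N, N\lhd G\}$ for $g\ne e$, and $\mathrm{RF}_{G,S}(r)=\max\{D_G(g)\mid e\neq g\in B_S(r)\}$ for real $r\geq 1$. For non-decreasing functions on $\mathbb{R}_{\ge1}$, $f\preceq g$ means there is $C>0$ with $f(r)\le C g(Cr)$ for all $r\ge\max\{1,1/C\}$, and $f\approx g$ means $f\preceq g$ and $g\preceq f$. $\mathrm{RF}_G$ is the $\approx$-class of $\mathrm{RF}_{G,S}$ (independent of $S$); $\log^k$ is $r\mapsto(\log r)^k$. The groups $G_\varphi$: $m,n\geq 1$. A bilinear map $\varphi:\mathbb{Z}^m\times\mathbb{Z}^m\to\mathbb{Z}^n$ is alternating if $\varphi(w,w')=-\varphi(w',w)$ for all $w,w'$, and full if its values generate a finite index subgroup of $\mathbb{Z}^n$. Write $\varphi(w,w')=(w^TA_1w',\dots,w^TA_nw')^T$ with $A_i\in\mathbb{Z}^{m\times m}$ skew-symmetric, let $A_i^L$ be $A_i$ with its upper triangular part set to zero, and $\varphi^L(w,w')=(w^TA_1^Lw',\dots,w^TA_n^Lw')^T$.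 $G_\varphi$ is the set $\mathbb{Z}^m\times\mathbb{Z}^n$ with product $(w_1,v_1)(w_2,v_2)=(w_1+w_2,v_1+v_2+\varphi^L(w_1,w_2))$; it is a torsion-free, finitely generated, two-step nilpotent group. The number $d(\varphi^{\mathbb{C}})$ is $$d(\varphi^{\mathbb{C}})=\min\Big\{\max_{1\le j\le n}\operatorname{rank}_{\mathbb{C}}\sum_{i=1}^n a^{(j)}_iA_i\ \Big|\ a^{(1)},\dots,a^{(n)}\text{ is a basis of }\mathbb{C}^n\Big\}.$$ *)

(* Defs.v *)
From HB Require Import structures.
From mathcomp Require Export all_boot all_order all_algebra complex.
From mathcomp Require Export all_classical all_reals all_analysis.

Set Implicit Arguments.
Unset Strict Implicit.
Unset Printing Implicit Defensive.

Import Order.TTheory GRing.Theory Num.Theory.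

Local Open Scope classical_set_scope.
Local Open Scope card_scope.
Local Open Scope ring_scope.

Section Groups.
Variable G : groupType.
Local Open Scope group_scope.

Definition subgroup (H : set G) : Prop :=
  [/\ H 1, forall x y, H x -> H y -> H (x * y) & forall x, H x -> H x^-1].

Definition normal_subgroup (N : set G) : Prop :=
  subgroup N /\ forall x y, N x -> N (x ^ y).

Definition generated (A : set G) : set G :=
  \bigcap_(H in [set H | subgroup H /\ A `<=` H]) H.

Definition lcosets (H : set G) : set (set G) :=
  [set [set x * h | h in H] | x in [set: G]].

Definition has_index (H : set G) (k : nat) : Prop := lcosets H #= `I_k.

Definition finite_index (H : set G) : Prop := finite_set (lcosets H).

End Groups.

Section ResidualFinitenessGrowth.
Variables (R : realType) (G : groupType).
Local Open Scope ereal_scope.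

(* The minimum of a set of natural numbers, as an extended real; the minimum of
   the empty set is +oo. *)
Definition min_nat (A : set nat) : \bar R :=
  ereal_inf [set (k%:R)%:E | k in A].

Definition word_norm (S : set G) (g : G) : \bar R :=
  min_nat [set size w | w in [set w : seq G |
    (forall x, x \in w -> S x \/ S (x^-1)%g) /\ (\prod_(x <- w) x)%g = g]].

Definition word_ball (S : set G) (r : R) : set G :=
  [set g | word_norm S g <= r%:E].

(* D_G(g) is +oo when no normal subgroup of finite index avoids g, so a finite
   upper bound for RF also asserts that the minima in question exist. *)
Definition DG (g : G) : \bar R :=
  min_nat [set k | exists N : set G,
    [/\ normal_subgroup N, ~ N g & has_index N k]].

(* For S finite, the ball is finite and this supremum is a maximum. *)
Definition RF (S : set G) (r : R) : \bar R :=
  ereal_sup [set DG g | g in [set g | g <> 1%g /\ word_ball S r g]].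

End ResidualFinitenessGrowth.

Arguments RF R {G} S r.

Definition preceq (R : realType) (f g : R -> \bar R) : Prop :=
  exists C : R, 0 < C /\
    forall r : R, Num.max 1 C^-1 <= r -> (f r <= C%:E * g (C * r)%R)%E.

Definition log_pow (R : realType) (k : nat) (r : R) : \bar R := (ln r ^+ k)%:E.

Arguments log_pow R k r : clear implicits.

(* The carrier ignores phi; the index selects the group law below. *)
Definition Gphi m n
    (phi : {bilinear 'cV[int]_m -> 'cV[int]_m -> 'cV[int]_n}) : Type :=
  ('cV[int]_m * 'cV[int]_n)%type.

Section Forms.
Variables m n : nat.
Variable phi : {bilinear 'cV[int]_m -> 'cV[int]_m -> 'cV[int]_n}.

Definition alternating : Prop := forall w w', phi w w' = - phi w' w.

(* to_multiplicative turns the additive group Z^n into a groupType. *)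
Definition full : Prop :=
  finite_index (generated (G := Algebra.to_multiplicative 'cV[int]_n)
    [set v | exists w w', v = phi w w']).

(* The matrix A_i with (phi w w')_i = w^T A_i w'; see phi_formmxE below. *)
Definition formmx (i : 'I_n) : 'M[int]_m :=
  \matrix_(j, k) phi (delta_mx j 0) (delta_mx k 0) i 0.

Lemma phi_formmxE w w' : phi w w' = \col_i (w^T *m formmx i *m w') 0 0.
Proof.
have dec (u : 'cV[int]_m) : u = \sum_j u j 0 *: delta_mx j 0.
  by rewrite [LHS]matrix_sum_delta; apply: eq_bigr => j _; rewrite big_ord1.
apply/colP => i; rewrite [in LHS](dec w) [in LHS](dec w') !mxE.
rewrite linear_sumr summxE; apply: eq_bigr => k _.
rewrite linearZr_LR linear_sumlz /= !mxE summxE mulrC.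
congr (_ * _); apply: eq_bigr => j _.
by rewrite linearZl_LR !mxE.
Qed.

(* The strictly lower triangular part: for alternating phi the diagonal of
   formmx i vanishes anyway. *)
Definition formmxL (i : 'I_n) : 'M[int]_m :=
  \matrix_(j, k) if (k < j)%N then formmx i j k else 0.

Definition phiL (w w' : 'cV[int]_m) : 'cV[int]_n :=
  \col_i (w^T *m formmxL i *m w') 0 0.

Lemma phiLE w w' i : phiL w w' i 0 = (w^T *m formmxL i *m w') 0 0.
Proof. by rewrite mxE. Qed.

Lemma phiLDl w1 w2 w : phiL (w1 + w2) w = phiL w1 w + phiL w2 w.
Proof. by apply/colP => i; rewrite [RHS]mxE !phiLE raddfD /= !mulmxDl [LHS]mxE. Qed.

Lemma phiLDr w w1 w2 : phiL w (w1 + w2) = phiL w w1 + phiL w w2.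
Proof. by apply/colP => i; rewrite [RHS]mxE !phiLE mulmxDr [LHS]mxE. Qed.

Lemma phiL0l w : phiL 0 w = 0.
Proof. by apply: (addrI (phiL 0 w)); rewrite -phiLDl !addr0. Qed.

Lemma phiL0r w : phiL w 0 = 0.
Proof. by apply: (addrI (phiL w 0)); rewrite -phiLDr !addr0. Qed.

Lemma phiLNl w w' : phiL (- w) w' = - phiL w w'.
Proof.
by apply: (addrI (phiL w w')); rewrite -phiLDl !subrr phiL0l.
Qed.

Lemma phiLNr w w' : phiL w (- w') = - phiL w w'.
Proof.
by apply: (addrI (phiL w w')); rewrite -phiLDr !subrr phiL0r.
Qed.

Definition Gphi_mul (x y : Gphi phi) : Gphi phi :=
  (x.1 + y.1, x.2 + y.2 + phiL x.1 y.1).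
Definition Gphi_one : Gphi phi := (0, 0).
Definition Gphi_inv (x : Gphi phi) : Gphi phi := (- x.1, - x.2 + phiL x.1 x.1).

Lemma Gphi_mulA : associative Gphi_mul.
Proof.
move=> [w1 v1] [w2 v2] [w3 v3]; rewrite /Gphi_mul /= phiLDl phiLDr addrA.
by congr pair; rewrite !addrA [LHS](ACl (1*2*5*3*6*4)).
Qed.

Lemma Gphi_mul1 : left_id Gphi_one Gphi_mul.
Proof. by move=> [w v]; rewrite /Gphi_mul /= !add0r phiL0l addr0. Qed.

Lemma Gphi_mulr1 : right_id Gphi_one Gphi_mul.
Proof. by move=> [w v]; rewrite /Gphi_mul /= !addr0 phiL0r addr0. Qed.

Lemma Gphi_mulV : left_inverse Gphi_one Gphi_inv Gphi_mul.
Proof.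
move=> [w v]; rewrite /Gphi_mul /= addNr phiLNl.
by rewrite addrAC addrK addNr.
Qed.

Lemma Gphi_mulrV : right_inverse Gphi_one Gphi_inv Gphi_mul.
Proof.
move=> [w v]; rewrite /Gphi_mul /= subrr phiLNr.
by rewrite addrA addrK subrr.
Qed.

HB.instance Definition _ := Choice.on (Gphi phi).
HB.instance Definition _ := isGroup.Build (Gphi phi)
  Gphi_mulA Gphi_mul1 Gphi_mulr1 Gphi_mulV Gphi_mulrV.

Section Rank.
Variable R : realType.

Definition comb (a : 'cV[complex R]_n) : 'M[complex R]_m :=
  \sum_(i < n) a i 0 *: map_mx intr (formmx i).

(* By basis_of, X lists exactly n vectors. *)
Definition dphi_set : set nat :=
  [set k | exists2 X : seq 'cV[complex R]_n,
    basis_of fullv X & k = \max_(a <- X) \rank (comb a)].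

Lemma dphi_set_nonempty : exists k, `[< dphi_set k >].
Proof.
exists (\max_(a <- vbasis (fullv : {vspace 'cV[complex R]_n})) \rank (comb a)).
by apply/asboolP; exists (vbasis fullv) => //; exact: vbasisP.
Qed.

Definition dphi : nat := ex_minn dphi_set_nonempty.

End Rank.
End Forms.

(* Main.v *)
(* A noncentral element is detected by reducing one coordinate modulo a prime.
   For a central element v, take a basis of C^n realizing d(phi^C). Written with
   rank factorizations, the existence of such a basis is a system of polynomial
   equations over Z. A solution over C specializes to the algebraic numbers and
   then, through a primitive element, to F_p for all but finitely many p modulo
   which a fixed irreducible f in Z[x] has a root. If v is nonzero modulo such a
   p, then a.v <> 0 for some basis vector a, and the form sum_i a_i A_i of rank
   at most d over F_p yields a normal subgroup of index at most p^(d+1) that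
   avoids v.

   It remains to find such a p of size O(log |v|), that is, to bound the sum of
   ln p over those p <= x below by a multiple of x. Let N be the norm form of
   Z[x]/(f), of degree n, and compare the means of ln |N| over translated boxes
   of sides X and AX: they differ by n ln A + O(1). Prime ideals of degree at
   least 2 and higher powers contribute O(1). An ideal (p, x - rho) with
   p <= X^n contains almost the same proportion of both boxes, with relative
   error O(p^(1/n) / X), so by Chebyshev's bound these contribute O(1) to the
   difference. For A large the growth must come from primes p between X^n and
   O((AX)^n) having a root of f. *)

Require Import Defs.
From mathcomp Require Import all_field perm ring lra zify.

Set Implicit Arguments.
Unset Strict Implicit.
Unset Printing Implicit Defensive.

Import Order.TTheory GRing.Theory Num.Theory.

Local Open Scope ring_scope.

(** * Specialization of rank certificates *)

(** A prime of logarithmic size needs a Chebyshev-type lower bound for the primes with a root of f,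
    valid at every scale; it is obtained by counting box points only. Factorization into prime
    ideals is replaced by lifting the factors of f mod p, which requires f to be squarefree mod p.
    The primes violating this, those dividing the denominator of the certificate and the small ones
    are gathered in one integer Q. The boxes are moved to a center that is 1 mod Q and dominates
    their side X, so that every norm is nonzero, prime to Q and between X^n and (bX)^n for a
    constant b. The comparison of the two scales is only needed as an inequality: primes up to X^n
    contribute at the larger scale at most O(1) more than at the smaller one, where the total is at
    most n ln(bX). Each larger prime has mean O(X^-n), so the missing growth forces the sum of their
    ln p to be at least c X^n. If all of them divided a nonzero integer u, so would their product,
    and ln |u| >= c X^n; the first scale where this fails yields the prime. Coordinates grow at most
    quadratically along words, which only doubles the logarithm. *)

Section Specialization.
Variables (K : fieldType) (A : idomainType) (io : {rmorphism A -> K}).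

(** Since [io] need not be injective, a leading coefficient may vanish in K; cutting h at the size
    of its image leaves one that survives. *)
Lemma truncate_poly (h : {poly A}) : map_poly io h != 0 ->
  exists2 g, map_poly io g = map_poly io h &
    (io (lead_coef g) != 0) && (size g <= size h)%N.
Proof.
move=> h0; set n := size (map_poly io h).
have n0 : (0 < n)%N by rewrite size_poly_gt0.
have le : (size (take_poly n h) <= n)%N by exact: size_take_poly.
have top : io (take_poly n h)`_n.-1 != 0.
  by rewrite coef_take_poly ltn_predL n0 -coef_map -lead_coef_eq0 // in h0 *.
have sz : size (take_poly n h) = n.
  apply/eqP; rewrite eqn_leq le leqNgt; apply: contraNN top => l.
  by rewrite nth_default ?rmorph0 // -ltnS prednK.
exists (take_poly n h).
  apply/polyP => i; rewrite !coef_map /= coef_take_poly.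
  by case: ltnP => // ni; rewrite rmorph0 -coef_map nth_default.
by rewrite lead_coefE sz top /= size_poly.
Qed.

(** Preimages of ideals of the image of A[x] in K[x]; working with preimages avoids quotient
    rings. *)
Definition ideal_mod_ker (I : {poly A} -> Prop) :=
  [/\ forall p q, I p -> I q -> I (p + q), forall r p, I p -> I (r * p)
    & forall p, map_poly io p = 0 -> I p].

(** Take h of least size among the elements of I whose leading coefficient survives. A
    pseudo-remainder modulo h lies in I; were its image nonzero, truncation would give a smaller
    such element. *)
Lemma pseudo_generator (I : {poly A} -> Prop) (h0 : {poly A}) :
  ideal_mod_ker I -> I h0 -> map_poly io h0 != 0 ->
  exists h, [/\ I h, io (lead_coef h) != 0
    & forall p, I p -> map_poly io (p %% h) = 0].
Proof.
move=> [Iadd Imul Iker] Ih0 nz0.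
have trunc p : I p -> map_poly io p != 0 ->
    exists g, [/\ I g, io (lead_coef g) != 0 & (size g <= size p)%N].
  move=> Ip /truncate_poly[g eg /andP[g0 sg]]; exists g; split => //.
  rewrite -[g](subrK p); apply: Iadd => //; apply: Iker.
  by rewrite rmorphB /= eg subrr.
pose P n := `[< exists h, [/\ I h, io (lead_coef h) != 0 & size h = n] >].
have exP : exists n, P n.
  have [g [Ig g0 _]] := trunc _ Ih0 nz0.
  by exists (size g); apply/asboolP; exists g.
case: (ex_minnP exP) => n /asboolP[h [Ih hl sh]] minh.
exists h; split => // p Ip; apply/eqP/negPn/negP => r0.
have hN0 : h != 0 by apply: contraNneq hl => ->; rewrite lead_coef0 rmorph0.
have Ir : I (p %% h).
  have e := Pdiv.Idomain.divp_eq p h.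
  have -> : p %% h = (lead_coef h ^+ scalp p h)%:P * p + - (p %/ h) * h.
    by rewrite mul_polyC e mulNr addrAC subrr add0r.
  by apply: Iadd; apply: Imul.
have [g [Ig g0 sg]] := trunc _ Ir r0.
have /minh : P (size g) by apply/asboolP; exists g.
by rewrite leqNgt -sh (leq_ltn_trans sg) // Pdiv.CommonIdomain.ltn_modp.
Qed.

End Specialization.

(* Asking that any given nonzero value survive is what makes the induction on
   the number of generators work. *)
Definition specializable (L : closedFieldType) (K : fieldType) (A : idomainType)
    (io : {rmorphism A -> K}) :=
  forall q, io q != 0 -> exists2 s : {rmorphism A -> L}, s q != 0 &
    forall r, io r = 0 -> s r = 0.

(** One generator b is adjoined. In the algebraic case b goes to a root y, in L, of the specialized
    minimal polynomial h of b, and a Bezout relation between q and h keeps q nonzero at y. *)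
Lemma specializable_step (L : closedFieldType) (K : fieldType) (A : idomainType)
    (io : {rmorphism A -> K}) (b : K) :
  specializable L io -> specializable L (horner_eval b \o map_poly io).
Proof.
move=> spec q q0.
have mapker (s : {rmorphism A -> L}) : (forall r, io r = 0 -> s r = 0) ->
    forall p, map_poly io p = 0 -> map_poly s p = 0.
  move=> ks p /polyP p0; apply/polyP => i; have := p0 i.
  by rewrite !coef_map !coef0; apply: ks.
have {}q0 : (map_poly io q).[b] != 0 by [].
(* Either b is algebraic over the image of A, or every polynomial vanishing at b already vanishes in
   K[x]; in the second case b may go to any non-root of the specialized q. *)
have [[h0 h0b h00]|trans] :=
  pselect (exists2 h, (map_poly io h).[b] = 0 & map_poly io h != 0); last first.
  have [q' qq' /andP[ql _]] : exists2 g, map_poly io g = map_poly io q &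
    (io (lead_coef g) != 0) && (size g <= size q)%N.
    by apply: truncate_poly; apply: contraNneq q0 => ->; rewrite horner0.
  have [s sq ks] := spec _ ql.
  have sq0 : map_poly s q != 0.
    have : map_poly s (q' - q) = 0 by apply: mapker => //; rewrite rmorphB /= qq' subrr.
    rewrite rmorphB /= => /subr0_eq <-.
    apply: contraNneq sq => /polyP /(_ (size q').-1).
    by rewrite coef_map coef0 /= => ->.
  have /closed_nonrootP[y /negPf yN] := sq0.
  exists (horner_eval y \o map_poly s); first by rewrite /= /horner_eval -rootE yN.
  move=> r rb /=; rewrite /horner_eval mapker ?horner0 //.
  by apply/eqP/negPn/negP => r0; apply: trans; exists r.
pose I1 (p : {poly A}) := (map_poly io p).[b] = 0.
have iI1 : ideal_mod_ker io I1.
  split=> [p p' Ip Ip'|r p Ip|p p0]; rewrite /I1.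
  - by rewrite rmorphD hornerD Ip Ip' addr0.
  - by rewrite rmorphM hornerM Ip mulr0.
  - by rewrite p0 horner0.
have [h [Ih hl hmin]] := pseudo_generator iI1 h0b h00.
pose I2 (p : {poly A}) := exists u w, map_poly io p = map_poly io (u * q + w * h).
have iI2 : ideal_mod_ker io I2.
  split=> [p p' [u [w e]] [u' [w' e']]|r p [u [w e]]|p p0]; rewrite /I2.
  - exists (u + u'), (w + w'); rewrite rmorphD /= e e' -rmorphD.
    by congr (map_poly _ _); rewrite !mulrDl addrACA.
  - exists (r * u), (r * w); rewrite rmorphM /= e -rmorphM.
    by congr (map_poly _ _); rewrite mulrDr !mulrA.
  - by exists 0, 0; rewrite !mul0r addr0 p0 rmorph0.
have nzh : map_poly io h != 0.
  by apply: contraNneq hl => /polyP/(_ (size h).-1); rewrite coef_map coef0 /= => ->.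
have I2h : I2 h by exists 0, 1; rewrite mul0r mul1r add0r.
have I2q : I2 q by exists 1, 0; rewrite mul0r mul1r addr0.
(* r acts as a gcd of q and h. It is constant: r divides h up to a scalar and is nonzero at b, so
   the quotient S vanishes at b, while h has least size among such polynomials. *)
have [r [[u [w ruw]] rl rmin]] := pseudo_generator iI2 I2h nzh.
have pdivE (g p : {poly A}) : map_poly io (p %% g) = 0 ->
    io (lead_coef g) ^+ scalp p g *: map_poly io p
    = map_poly io (p %/ g) * map_poly io g.
  move=> e; rewrite -rmorphM -[RHS]addr0 -e -rmorphD /=.
  by rewrite -Pdiv.Idomain.divp_eq map_polyZ rmorphXn.
have rb : (map_poly io r).[b] != 0.
  apply: contraNneq q0 => rb0; have := pdivE _ _ (rmin _ I2q).
  move/(congr1 (fun p => p.[b])); rewrite hornerZ hornerM rb0 mulr0 => /eqP.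
  by rewrite mulf_eq0 expf_eq0 (negPf rl) andbF.
pose S := h %/ r.
have eS := pdivE _ _ (rmin _ I2h).
have Sb : (map_poly io S).[b] = 0.
  have := congr1 (fun p => p.[b]) eS; rewrite hornerZ hornerM Ih mulr0 => /esym/eqP.
  by rewrite mulf_eq0 (negPf rb) orbF => /eqP.
have szio (p : {poly A}) : io (lead_coef p) != 0 -> size (map_poly io p) = size p.
  by move=> pl; rewrite size_map_poly_id0.
have hNsmall p : map_poly io p != 0 -> (map_poly io p).[b] = 0 ->
    (size h <= size (map_poly io p))%N.
  move=> p0 pb; have := pdivE _ _ (hmin _ pb).
  move=> e; rewrite -(szio h) // -(size_scale (map_poly io p) (expf_neq0 (scalp p h) hl)).
  by apply: dvdp_leq; rewrite ?e ?dvdp_mull // -e scaler_eq0 expf_eq0 (negPf hl) andbF.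
have r1 : size r = 1%N.
  have S0 : map_poly io S != 0.
    apply: contraNneq nzh => S0; move: eS; rewrite -/S S0 mul0r => /eqP.
    by rewrite scaler_eq0 expf_eq0 (negPf rl) andbF.
  have rnz : map_poly io r != 0 by apply: contraNneq rb => ->; rewrite horner0.
  have := size_mul S0 rnz; rewrite -eS size_scale ?expf_neq0 //.
  rewrite (szio r) // (szio h) //; have := hNsmall _ S0 Sb.
  move: rnz; rewrite -size_poly_gt0 szio //.
  move: (size h) (size (map_poly io S)) (size r) => k l [//|[//|n]] _ lkl e.
  by move: lkl; rewrite e !addnS /= ltnNge leq_addr.
(* The leading coefficient of h must survive for its image to have a root y and for division by h to
   specialize; that of r makes u q + w h nonzero at y. *)
have [|s slc ks] := spec (lead_coef h * lead_coef r).
  by rewrite rmorphM mulf_neq0.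
move: slc; rewrite rmorphM mulf_eq0 negb_or => /andP[sh sr].
have szsh : size (map_poly s h) = size h by rewrite size_map_poly_id0.
have : size (map_poly s h) != 1%N.
  rewrite szsh; apply/eqP => /eqP h1; move: Ih nzh; rewrite /I1.
  have /size_poly1P[c c0 ->] : size (map_poly io h) == 1%N by rewrite szio.
  by rewrite hornerC => /eqP; rewrite (negPf c0).
move=> /closed_rootP[y /rootP yh].
exists (horner_eval y \o map_poly s); last first.
  move=> p pb; rewrite /= /horner_eval.
  have /(mapker _ ks) sm := hmin _ pb.
  have := Pdiv.Idomain.divp_eq p h => /(congr1 (map_poly s)).
  rewrite rmorphD /= sm addr0 rmorphM /= => /(congr1 (fun p => p.[y])).
  rewrite hornerM yh mulr0 map_polyZ hornerZ => /eqP.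
  by rewrite rmorphXn mulf_eq0 expf_eq0 (negPf sh) andbF => /eqP.
rewrite /= /horner_eval.
have : map_poly s (u * q + w * h - r) = 0.
  by apply: mapker => //; rewrite rmorphB /= ruw subrr.
rewrite rmorphB => /eqP; rewrite subr_eq0 => /eqP /(congr1 (fun p => p.[y])).
rewrite rmorphD !rmorphM /= hornerD !hornerM yh mulr0 addr0.
have -> : r = (lead_coef r)%:P by rewrite lead_coefE r1; apply: size1_polyC; rewrite r1.
rewrite map_polyC hornerC /= => e.
by apply: contraNneq sr => qy; rewrite -e qy mulr0.
Qed.

(** A is an iterated polynomial ring over Z, one variable for each element of [xs]. It need not
    embed in K; instead the kernel of [io] is required to die under s, so polynomial relations
    between the [xs] persist in L. *)
Lemma exists_specialization (L : closedFieldType) (K : numFieldType) (xs : seq K) :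
  [pchar L] =i pred0 ->
  exists (A : idomainType) (io : {rmorphism A -> K}) (s : {rmorphism A -> L}),
    (forall r, io r = 0 -> s r = 0) /\ forall x, x \in xs -> exists a, io a = x.
Proof.
move=> charL.
suff [A [io [spec lift]]] : exists (A : idomainType) (io : {rmorphism A -> K}),
    specializable L io /\ forall x, x \in xs -> exists a, io a = x.
  have [|s _ ks] := spec 1; first by rewrite rmorph1 oner_eq0.
  by exists A, io, s.
elim: xs => [|x xs [A [io [spec lift]]]].
  exists int, (intr : {rmorphism int -> K}); split => // q; rewrite intr_eq0 => q0.
  exists (intr : {rmorphism int -> L}); last first.
    by move=> r /eqP; rewrite intr_eq0 => /eqP ->; rewrite rmorph0.
  have nat0 n : (n.+1%:R == 0 :> L) = false.
    apply/negP => n0.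
    by have [p] := natf0_pchar (ltn0Sn n) n0; rewrite charL.
  by case: q q0 => [[|n]|n] //= _; rewrite ?NegzE ?rmorphN ?oppr_eq0 nat0.
exists {poly A}, (horner_eval x \o map_poly io); split.
  exact: specializable_step.
move=> y; rewrite inE => /orP[/eqP ->|/lift[a <-]].
  by exists 'X; rewrite /= /horner_eval map_polyX hornerX.
by exists a%:P; rewrite /= /horner_eval map_polyC hornerC.
Qed.

Section RankCertificate.
Variables (m n d : nat) (Am : 'I_n -> 'M[int]_m).

(* The columns of b form a basis, and l j *m u j bounds the rank of the form
   attached to column j by d; these polynomial equations over Z are preserved by
   specialization. *)
Definition rank_certificate_for (F : fieldType) (b b' : 'M[F]_n)
    (l : 'I_n -> 'M[F]_(m, d)) (u : 'I_n -> 'M[F]_(d, m)) :=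
  b *m b' = 1%:M /\
  forall j, \sum_i b i j *: map_mx intr (Am i) = l j *m u j.

Definition rank_certificate (F : fieldType) :=
  exists b b' l u, @rank_certificate_for F b b' l u.

Definition certificate_entries (F : fieldType) (b b' : 'M[F]_n)
    (l : 'I_n -> 'M[F]_(m, d)) (u : 'I_n -> 'M[F]_(d, m)) : seq F :=
  [seq b ij.1 ij.2 | ij : 'I_n * 'I_n] ++ [seq b' ij.1 ij.2 | ij : 'I_n * 'I_n]
  ++ [seq l jik.1 jik.2.1 jik.2.2 | jik : 'I_n * ('I_m * 'I_d)]
  ++ [seq u jik.1 jik.2.1 jik.2.2 | jik : 'I_n * ('I_d * 'I_m)].

(** D is a common denominator: only D times each entry has to lift to A. The equations, multiplied
    by D^2, become relations in the kernel of [io], and D is divided out again in F. *)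
Lemma rank_certificate_transfer (K F : fieldType) (A : comNzRingType)
    (io : {rmorphism A -> K}) (s : {rmorphism A -> F}) (D : A)
    (b b' : 'M[K]_n) l u :
  (forall r, io r = 0 -> s r = 0) -> s D != 0 ->
  rank_certificate_for b b' l u ->
  (forall x, x \in certificate_entries b b' l u -> exists a, io a = io D * x) ->
  rank_certificate F.
Proof.
move=> ks sD [bb' lu] lift.
have /choice[g gE] : forall x, exists a,
    x \in certificate_entries b b' l u -> io a = io D * x.
  move=> x; case: (boolP (x \in certificate_entries b b' l u)) => [/lift[a]|] h.
    by exists a.
  by exists 0.
have mapg p q (M : 'M[K]_(p, q)) :
    (forall i j, M i j \in certificate_entries b b' l u) ->
    map_mx io (map_mx g M) = io D *: M.
  by move=> M_in; apply/matrixP => i j; rewrite !mxE gE.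
have kmx p q (M : 'M[A]_(p, q)) : map_mx io M = 0 -> map_mx s M = 0.
  move=> /matrixP M0; apply/matrixP => i j; have := M0 i j.
  by rewrite !mxE => /ks.
have bE : map_mx io (map_mx g b) = io D *: b.
  apply: mapg => i j; rewrite !mem_cat; apply/orP; left.
  by apply/fintype.imageP; exists (i, j).
have b'E : map_mx io (map_mx g b') = io D *: b'.
  apply: mapg => i j; rewrite !mem_cat; apply/orP; right; apply/orP; left.
  by apply/fintype.imageP; exists (i, j).
have lE k : map_mx io (map_mx g (l k)) = io D *: l k.
  apply: mapg => i j; rewrite !mem_cat; do 2![apply/orP; right]; apply/orP; left.
  by apply/fintype.imageP; exists (k, (i, j)).
have uE k : map_mx io (map_mx g (u k)) = io D *: u k.
  apply: mapg => i j; rewrite !mem_cat; do 3![apply/orP; right].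
  by apply/fintype.imageP; exists (k, (i, j)).
have bb'A : map_mx s (map_mx g b) *m map_mx s (map_mx g b') = (s D ^+ 2)%:M.
  apply/eqP; rewrite -subr_eq0 -map_mxM -rmorphXn -map_scalar_mx -map_mxB; apply/eqP.
  apply: kmx; rewrite map_mxB map_mxM bE b'E map_scalar_mx /= -scalemxAl -scalemxAr.
  by rewrite bb' scalerA scalemx1 rmorphXn expr2 subrr.
(* The left side is linear in the entries and the right side quadratic, hence the extra factor
   [s D]. *)
have luA j : s D *: \sum_i (map_mx s (map_mx g b)) i j *: map_mx intr (Am i) =
    map_mx s (map_mx g (l j)) *m map_mx s (map_mx g (u j)).
  pose M : 'M[A]_m := D *: \sum_i (map_mx g b) i j *: map_mx intr (Am i)
    - map_mx g (l j) *m map_mx g (u j).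
  have mapM (B : fieldType) (f : {rmorphism A -> B}) : map_mx f M =
      f D *: \sum_i (map_mx f (map_mx g b)) i j *: map_mx intr (Am i)
      - map_mx f (map_mx g (l j)) *m map_mx f (map_mx g (u j)).
    rewrite map_mxB map_mxM map_mxZ /= map_mx_sum /=; congr (_ *: _ - _).
    apply: eq_bigr => i _; rewrite map_mxZ /= !mxE; congr (_ *: _).
    by apply/matrixP => x y; rewrite !mxE rmorph_int.
  apply/eqP; rewrite -subr_eq0 -mapM; apply/eqP/kmx.
  rewrite mapM bE lE uE -scalemxAl -scalemxAr -lu.
  rewrite (eq_bigr (fun i => io D *: (b i j *: map_mx intr (Am i)))) => [|i _].
    by rewrite -scaler_sumr subrr.
  by rewrite !mxE scalerA.
exists ((s D)^-1 *: map_mx s (map_mx g b)), ((s D)^-1 *: map_mx s (map_mx g b')).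
exists (fun j => (s D)^-1 *: map_mx s (map_mx g (l j))).
exists (fun j => (s D)^-1 *: map_mx s (map_mx g (u j))); split.
  rewrite -scalemxAl -scalemxAr bb'A !scale_scalar_mx expr2.
  by rewrite mulKf // mulVf.
move=> j; rewrite -scalemxAl -scalemxAr -luA !scalerA -mulrA mulVf // mulr1.
rewrite scaler_sumr; apply: eq_bigr => i _.
by rewrite mxE scalerA.
Qed.

End RankCertificate.

(** * From algebraic numbers to finite fields *)

Local Notation pQtoC := (map_poly (ratr : rat -> algC)).

(** If a clears the denominators of the minimal polynomial q of z, of degree k, then a^k q(x/a) is
    monic, integral and vanishes at a z. *)
Lemma Aint_multiple (z : algC) : exists2 a : int, a != 0 & a%:~R * z \in Aint.
Proof.
have [q [_ q_monic] rootq] := minCpolyP z.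
have qz : root (pQtoC q) z by rewrite rootq.
have [Q [a a0 qE]] := rat_poly_scale q.
pose k := (size q).-1.
have sq : size q = k.+1 by rewrite prednK // size_poly_gt0 monic_neq0.
have QE i : (Q`_i)%:~R = a%:~R * q`_i :> rat.
  by rewrite qE coefZ coef_map mulrA mulfV ?intr_eq0 // mul1r.
have k0 : (0 < k)%N.
  rewrite /k -(size_map_poly (ratr : {rmorphism rat -> algC})) -subn1 subn_gt0.
  by apply: root_size_gt1 qz; rewrite map_poly_eq0 monic_neq0.
exists a => //.
pose f : {poly int} := 'X^k + \poly_(i < k) (Q`_i * a ^+ (k.-1 - i)).
have f_monic : map_poly (intr : int -> algC) f \is monic.
  rewrite monic_map // monicE lead_coefDl ?lead_coefXn // size_polyXn.
  by rewrite ltnS size_poly.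
apply: (root_monic_Aint _ f_monic); last first.
  by apply/polyOverP => i; rewrite coef_map /= intr_int.
rewrite rootE rmorphD /= map_polyXn hornerD hornerXn.
set P := \poly_(i < k) _.
have -> : map_poly intr P = \poly_(i < k) (Q`_i * a ^+ (k.-1 - i))%:~R :> {poly algC}.
  by apply/polyP => i; rewrite coef_map !coef_poly; case: ifP.
rewrite horner_poly.
have term i : (i < k)%N -> (Q`_i * a ^+ (k.-1 - i))%:~R * (a%:~R * z) ^+ i
     = a%:~R ^+ k * (ratr q`_i * z ^+ i).
  move=> ik; rewrite intrM -(ratr_int _ Q`_i) QE rmorphM /= ratr_int.
  have -> : a%:~R ^+ k = a%:~R * a%:~R ^+ (k.-1 - i) * a%:~R ^+ i :> algC.
    by rewrite -exprS -exprD; congr (_ ^+ _); lia.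
  by rewrite rmorphXn /= exprMn; ring.
rewrite (eq_bigr (fun i : 'I_k => a%:~R ^+ k * (ratr q`_i * z ^+ i))) => [|i _]; last first.
  exact: term.
rewrite -mulr_sumr exprMn -mulrDr; apply/eqP.
have : (pQtoC q).[z] = 0 by exact/rootP.
rewrite horner_coef size_map_poly sq big_ord_recr /= !coef_map /=.
rewrite -[q`_k]/(lead_coef q) (monicP q_monic) rmorph1 mul1r => e.
rewrite -[X in _ * (_ + X)](_ : - z ^+ k = _) ?subrr ?mulr0 //.
apply/eqP; rewrite eq_sym -subr_eq0 opprK -[X in _ == X]e; apply/eqP; congr (_ + _).
by apply: eq_bigr => i _; rewrite coef_map.
Qed.

(* Irreducibility over Q of a monic f, with the Bezout identity cleared of
   denominators. *)
Definition coprime_below (f : {poly int}) :=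
  forall c : {poly int}, c != 0 -> (size c < size f)%N ->
  exists u v (w : int), w != 0 /\ u * c + v * f = w%:P.

(** The gcd of c and the minimal polynomial q is nonzero at z for degree reasons, so its cofactor in
    q vanishes there and has full degree; the gcd is thus constant. *)
Lemma integral_minimal_poly (z : algC) : z \in Aint ->
  exists f : {poly int}, [/\ f \is monic, (1 < size f)%N, coprime_below f &
    (map_poly (intr : int -> algC) f).[z] = 0].
Proof.
have [q [qE q_monic] rootq] := minCpolyP z.
rewrite unfold_in => /floorpP[f fE].
have fq : q = map_poly intr f.
  apply: (map_poly_inj (ratr : {rmorphism rat -> algC})).
  rewrite /= -qE fE -map_poly_comp; apply: eq_map_poly => c /=.
  by rewrite ratr_int.
have szf : size f = size q.
  by rewrite fq size_map_inj_poly //; exact: (@intr_inj rat).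
have f_monic : f \is monic.
  rewrite monicE -(inj_eq (@intr_inj rat)) -lead_coef_map_inj //; last exact: (@intr_inj rat).
  by rewrite -fq (monicP q_monic).
have fz : (map_poly (intr : int -> algC) f).[z] = 0.
  by apply/rootP; rewrite -fE root_minCpoly.
exists f; split => //.
  by rewrite szf -(size_map_poly (ratr : {rmorphism rat -> algC})) -qE size_minCpoly.
have q_min (g : {poly rat}) : g != 0 -> (size g < size q)%N ->
    ~~ root (pQtoC g) z.
  by move=> g0 sg; rewrite rootq; apply/negP => /(dvdp_leq g0); rewrite leqNgt sg.
move=> c c0 sc.
have cp : coprimep (map_poly intr c : {poly rat}) q.
  rewrite coprimep_def; set g := gcdp _ _.
  have gq : g %| q by exact: dvdp_gcdr.
  have c0' : map_poly intr c != 0 :> {poly rat}.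
    by rewrite map_poly_eq0_id0 // intr_eq0 lead_coef_eq0.
  have sg : (size g < size q)%N.
    apply: leq_ltn_trans (dvdp_leq c0' (dvdp_gcdl _ _)) _.
    by rewrite -szf size_map_inj_poly //; exact: (@intr_inj rat).
  have g0 : g != 0 by rewrite gcdp_eq0 negb_and c0'.
  have := root_minCpoly z; rewrite qE -(divpK gq) rmorphM rootM.
  rewrite (negPf (q_min _ g0 sg)) orbF; have d0 : q %/ g != 0.
    by apply: contraNneq (monic_neq0 q_monic) => d0; rewrite -(divpK gq) d0 mul0r.
  rewrite rootq => /(dvdp_leq d0); rewrite size_divp // => le.
  move: g0 sg le; rewrite -size_poly_gt0; case: (size g) => [//|[//|n]] _ /=.
  by move=> lt; rewrite leqNgt ltn_subrL (leq_trans _ lt).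
have [[u v] /= uv] := Bezout_eq1_coprimepP _ _ cp.
have [U [a a0 uE]] := rat_poly_scale u.
have [V [b b0 vE]] := rat_poly_scale v.
exists (b *: U), (a *: V), (a * b); split; first by rewrite mulf_neq0.
apply: (map_inj_poly (intr_inj : injective (intr : int -> rat))) => //.
have a0' : a%:~R != 0 :> rat by rewrite intr_eq0.
have b0' : b%:~R != 0 :> rat by rewrite intr_eq0.
rewrite rmorphD !rmorphM /= -fq !map_polyZ /= !map_polyC /=.
have -> : map_poly intr U = a%:~R *: u :> {poly rat}.
  by rewrite uE scalerA mulfV ?scale1r.
have -> : map_poly intr V = b%:~R *: v :> {poly rat}.
  by rewrite vE scalerA mulfV ?scale1r.
rewrite !scalerA -!scalerAl (mulrC a%:~R) -scalerDr uv -polyCM mulrC.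
by rewrite alg_polyC.
Qed.

Lemma common_denominator (z : algC) (xs : seq algC) :
  (forall x, x \in xs -> exists p : {poly rat}, x = (pQtoC p).[z]) ->
  exists2 D : int, D != 0 & forall x, x \in xs ->
    exists P : {poly int}, (map_poly intr P).[z] = D%:~R * x.
Proof.
elim: xs => [|x xs IH] h; first by exists 1.
have [|D D0 DP] := IH; first by move=> y yin; apply: h; rewrite inE yin orbT.
have [p xE] := h x (mem_head _ _).
have [P [a a0 pE]] := rat_poly_scale p.
exists (D * a); first by rewrite mulf_neq0.
have a0' : a%:~R != 0 :> algC by rewrite intr_eq0.
move=> y; rewrite inE => /orP[/eqP ->|/DP[R RE]]; last first.
  by exists (a *: R); rewrite map_polyZ hornerZ /= RE intrM; ring.
exists (D *: P); rewrite map_polyZ hornerZ /= xE pE map_polyZ hornerZ /= intrM.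
rewrite fmorphV /= ratr_int mulrA mulfK //; congr (_ * _.[_]).
by rewrite -map_poly_comp; apply: eq_map_poly => c /=; rewrite ratr_int.
Qed.

(** The entries lie in a number field with an integral generator of minimal polynomial f; sending
    this generator to a root of f in F_p is legitimate once p avoids their common denominator, which
    is Q. *)
Lemma finite_field_certificate (m n d : nat) (Am : 'I_n -> 'M[int]_m) :
  rank_certificate d Am algC ->
  exists (f : {poly int}) (Q : nat), [/\ f \is monic, (1 < size f)%N, coprime_below f,
    (0 < Q)%N & forall p (rho : 'F_p), prime p -> ~~ (p %| Q)%N ->
      root (map_poly intr f) rho -> rank_certificate d Am 'F_p].
Proof.
move=> [b [b' [l [u cert]]]].
set xs := certificate_entries b b' l u.
have [z _ [ps xsE]] := algC_PET xs.
have [a a0 az] := Aint_multiple z.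
have [f [f_monic f1 f_min fz]] := integral_minimal_poly az.
have [|D D0 lift] := common_denominator (z := a%:~R * z) (xs := xs).
  move=> x; rewrite xsE => /mapP[p _ ->].
  (* The entries are polynomials in z; rescaling the variable expresses them in the integral element
     a z. *)
  exists (p \Po (a%:~R^-1 *: 'X)).
  rewrite map_comp_poly horner_comp map_polyZ map_polyX hornerZ hornerX /=.
  by rewrite fmorphV /= ratr_int mulKf // intr_eq0.
exists f, `|D|%N; split; rewrite ?absz_gt0 // => p rho p_prime pD frho.
pose io : {rmorphism {poly int} -> algC} := horner_eval (a%:~R * z) \o map_poly intr.
pose s : {rmorphism {poly int} -> 'F_p} := horner_eval rho \o map_poly intr.
apply: (@rank_certificate_transfer m n d Am _ _ _ io s D%:P _ _ _ _ _ _ cert).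
(* f divides every r vanishing at a z: a nonzero remainder would, by Bezout, make a nonzero integer
   vanish at a z. Hence r also vanishes at [rho]. *)
- move=> r; rewrite /= /horner_eval => rz.
  have := Pdiv.IdomainMonic.divp_eq f_monic r => rE.
  have [r0|r0] := eqVneq (r %% f) 0.
    move: rE; rewrite r0 addr0 => ->.
    by rewrite rmorphM hornerM (rootP frho) mulr0.
  have [|u' [v' [w [w0 uvw]]]] := f_min _ r0; first by rewrite ltn_modp monic_neq0.
  have := congr1 (fun g => (map_poly (intr : int -> algC) g).[a%:~R * z]) uvw.
  have rmz : (map_poly (intr : int -> algC) (r %% f)).[a%:~R * z] = 0.
    move: rz; rewrite [X in map_poly _ X]rE rmorphD rmorphM hornerD hornerM fz.
    by rewrite mulr0 add0r.
  rewrite rmorphD !rmorphM /= hornerD !hornerM fz rmz !mulr0 addr0.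
  by rewrite map_polyC hornerC /= => /esym/eqP; rewrite intr_eq0 (negPf w0).
- rewrite /= /horner_eval map_polyC hornerC /=; apply: contra pD.
  have -> : D = (Num.sg D) * `|D|%:Z by rewrite abszE -numEsg.
  rewrite rmorphM /= mulf_eq0 => /orP[|].
    case: (sgrP D) D0 => //= _ _.
    by rewrite rmorphN1 oppr_eq0 oner_eq0.
  by rewrite -pmulrn -(dvdn_pcharf (pchar_Fp p_prime)) abszM absz_sg D0 mul1n absz_nat.
move=> x /lift[P PE]; exists P; rewrite /= /horner_eval.
by rewrite map_polyC hornerC.
Qed.

(** * The norm form of Z[x]/(f) *)

Section Companion.
Variables (R : comNzRingType) (k : nat).

(** For f monic of degree k+1, this companion matrix T is multiplication by x modulo f in the basis
    1, ..., x^k, acting on row vectors; c(T) is multiplication by c. *)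
Definition cmx (f : {poly R}) : 'M[R]_k.+1 :=
  \matrix_(i, j) if i == ord_max then - f`_j else (i.+1 == j)%:R.

Local Notation e0 := (delta_mx 0 0 : 'rV[R]_k.+1).

Lemma delta_cmx_exp f (i : 'I_k.+1) : e0 *m cmx f ^+ i = delta_mx 0 i.
Proof.
case: i => i; elim: i => [|i IH] ik /=.
  by rewrite mulmx1; congr delta_mx; apply: val_inj.
rewrite exprSr -[_ * _]/(_ *m _) mulmxA (IH (ltnW ik)) -rowE.
apply/rowP => j; rewrite !mxE -val_eqE /= ltn_eqF //=.
by rewrite -val_eqE /= eq_sym.
Qed.

Lemma horner_mx_sum (T : 'M[R]_k.+1) n (c : {poly R}) : (size c <= n)%N ->
  horner_mx T c = \sum_(i < n) c`_i *: T ^+ i.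
Proof.
move=> cn; rewrite -[in LHS](coefK c) poly_def rmorph_sum /=.
rewrite (big_ord_widen n (fun i => horner_mx T (c`_i *: 'X^i)) cn) big_mkcond /=.
apply: eq_bigr => i _; case: ltnP => ci; last by rewrite nth_default // scale0r.
by rewrite linearZ rmorphXn /= horner_mx_X.
Qed.

Lemma horner_cmx_row0 f (c : {poly R}) : (size c <= k.+1)%N ->
  e0 *m horner_mx (cmx f) c = poly_rV c.
Proof.
move=> ck; rewrite (horner_mx_sum _ ck) mulmx_sumr.
rewrite [RHS]row_sum_delta; apply: eq_bigr => i _.
by rewrite -scalemxAr delta_cmx_exp mxE.
Qed.

Lemma row_horner_cmx f c (i : 'I_k.+1) :
  row i (horner_mx (cmx f) c) = e0 *m horner_mx (cmx f) ('X^i * c).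
Proof.
rewrite rowE -(delta_cmx_exp f i) rmorphM rmorphXn /= horner_mx_X.
by rewrite -[_ * horner_mx _ _]/(_ *m _) mulmxA.
Qed.

(** Row i is e0 T^i f(T) = e0 f(T) T^i, so only row 0 matters, and the last row of T was chosen to
    kill it. *)
Lemma horner_cmx_self f : f \is monic -> size f = k.+2 -> horner_mx (cmx f) f = 0.
Proof.
move=> f_monic sf.
have fT0 : e0 *m horner_mx (cmx f) f = 0.
  rewrite (horner_mx_sum _ (eq_leq sf)) mulmx_sumr big_ord_recr /=.
  rewrite -[f`_k.+1]/(f`_k.+2.-1) -sf -lead_coefE (monicP f_monic) scale1r.
  rewrite exprSr -[_ * _]/(_ *m _) mulmxA (delta_cmx_exp f ord_max) -rowE.
  rewrite (eq_bigr (fun i : 'I_k.+1 => f`_i *: delta_mx 0 i)) => [|i _]; last first.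
    by rewrite -scalemxAr delta_cmx_exp.
  apply/rowP => j; rewrite !mxE eqxx summxE (bigD1 j) //= !mxE !eqxx mulr1.
  rewrite big1 ?addr0 ?subrr // => i ij.
  by rewrite !mxE eqxx /= eq_sym (negPf ij) mulr0.
apply/row_matrixP => i; rewrite row_horner_cmx mulrC rmorphM /= -[_ * _]/(_ *m _).
by rewrite mulmxA fT0 mul0mx row0.
Qed.

(** Pairing a coefficient row with the column of powers of [rho] is evaluation at [rho], which turns
    multiplication by x into multiplication by [rho]. *)
Lemma cmx_eigenvector f (rho : R) : f \is monic -> size f = k.+2 -> root f rho ->
  cmx f *m \col_i rho ^+ i = rho *: \col_i rho ^+ i.
Proof.
move=> f_monic sf /rootP frho; apply/colP => i; rewrite !mxE -exprS.
have [->|/negPf ik] := eqVneq i ord_max; last first.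
  have ik1 : (i.+1 < k.+1)%N.
    by rewrite ltnS ltn_neqAle -ltnS ltn_ord andbT; rewrite -val_eqE in ik; rewrite ik.
  rewrite (bigD1 (Ordinal ik1)) //= !mxE ik /= eqxx mul1r big1 ?addr0 // => j ji.
  by rewrite !mxE ik eq_sym; move: ji; rewrite -val_eqE /= => /negPf ->; rewrite mul0r.
move: frho; rewrite horner_coef sf big_ord_recr /=.
rewrite -[f`_k.+1]/(f`_k.+2.-1) -sf -lead_coefE (monicP f_monic) mul1r.
move/eqP; rewrite addrC addr_eq0 => /eqP ->; rewrite -sumrN.
by apply: eq_bigr => j _; rewrite !mxE eqxx mulNr.
Qed.

Lemma horner_cmx_eigenvector f (rho : R) c :
  f \is monic -> size f = k.+2 -> root f rho ->
  horner_mx (cmx f) c *m \col_i rho ^+ i = c.[rho] *: \col_i rho ^+ i.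
Proof.
move=> f_monic sf frho; elim/poly_ind: c => [|c a IH].
  by rewrite rmorph0 mul0mx horner0 scale0r.
rewrite rmorphD rmorphM /= horner_mx_X horner_mx_C mulmxDl -mulmxA.
rewrite cmx_eigenvector // -scalemxAr IH mul_scalar_mx hornerMXaddC scalerA.
by rewrite -scalerDl mulrC.
Qed.

End Companion.

Lemma map_cmx (R S : comNzRingType) (g : {rmorphism R -> S}) k (f : {poly R}) :
  map_mx g (cmx k f) = cmx k (map_poly g f).
Proof.
apply/matrixP => i j; rewrite !mxE; case: ifP => _.
  by rewrite rmorphN coef_map.
by rewrite rmorph_nat.
Qed.

(** c(T) factors through g(T), and g(T) annihilates (f/g)(T). The latter has rank at least deg g,
    since the multiples x^i f/g with i < deg g are independent and of degree below deg f. *)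
Lemma rank_horner_cmx (F : fieldType) k (f g c : {poly F}) :
  f \is monic -> size f = k.+2 -> g %| f -> g %| c ->
  (\rank (horner_mx (cmx k f) c) + (size g).-1 <= k.+1)%N.
Proof.
move=> f_monic sf gf gc; pose T := cmx k f.
have f0 := monic_neq0 f_monic.
have g0 : g != 0 by apply: contraNneq f0 => g0; move: gf; rewrite g0 dvd0p.
have h0 : f %/ g != 0 by apply: contraNneq f0 => h0; rewrite -(divpK gf) h0 mul0r.
have rc : (\rank (horner_mx T c) <= \rank (horner_mx T g))%N.
  by rewrite -(divpK gc) rmorphM /= mxrankM_maxr.
have rgh : (\rank (horner_mx T (f %/ g)) + \rank (horner_mx T g) <= k.+1)%N.
  by apply: mulmx0_rank_max; rewrite -[_ *m _]rmorphM /= divpK // horner_cmx_self.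
have rh : ((size g).-1 <= \rank (horner_mx T (f %/ g)))%N.
  pose W : 'M[F]_((size g).-1, k.+1) :=
    \matrix_(i < (size g).-1) (delta_mx 0 0 *m horner_mx T 'X^i).
  suff /eqP <- : row_free (W *m horner_mx T (f %/ g)) by exact: mxrankM_maxr.
  apply: inj_row_free => v; set u := rVpoly v.
  have -> : v *m (W *m horner_mx T (f %/ g)) =
      delta_mx 0 0 *m horner_mx T (u * (f %/ g)).
    rewrite rmorphM /= -[_ * horner_mx _ _]/(_ *m _) !mulmxA; congr (_ *m _).
    have su : (size u <= (size g).-1)%N by exact: size_poly.
    rewrite (horner_mx_sum T su).
    rewrite mulmx_sumr mulmx_sum_row; apply: eq_bigr => i _.
    by rewrite rowK coef_rVpoly_ord rmorphXn /= horner_mx_X -scalemxAr.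
  have szu : (size (u * (f %/ g))%R <= k.+1)%N.
    apply: leq_trans (size_polyMleq _ _) _; rewrite size_divp // sf.
    have : (size u <= (size g).-1)%N by exact: size_poly.
    have : (0 < size g)%N by rewrite size_poly_gt0.
    have : (size g <= size f)%N by exact: dvdp_leq.
    rewrite sf; move: (size g) (size u) => a b; lia.
  rewrite horner_cmx_row0 // => /(congr1 rVpoly); rewrite poly_rV_K // linear0.
  move/eqP; rewrite mulf_eq0 (negPf h0) orbF => /eqP u0.
  by rewrite -[v]rVpolyK -/u u0 linear0.
by move: rc rgh rh; rewrite -/T; lia.
Qed.

Lemma dvdz_prod_exp (I : finType) (P : pred I) (F : I -> int) (p : int) :
  (forall i, P i -> (p %| F i)%Z) -> (p ^+ #|P| %| \prod_i F i)%Z.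
Proof.
move=> pF; rewrite (bigID P) /=; apply: dvdz_mulr.
rewrite -prodr_const; elim/big_rec2: _ => // i a b Pi ab.
exact: dvdz_mul (pF _ Pi) ab.
Qed.

Lemma Fp_intr_eq0 p (x : int) : prime p -> (x%:~R == 0 :> 'F_p) = (p %| `|x|)%N.
Proof.
move=> p_prime; have chF := pchar_Fp p_prime.
by case: x => n; rewrite ?NegzE ?mulrNz ?oppr_eq0 ?abszN absz_nat -pmulrn (dvdn_pcharf chF).
Qed.

Lemma Fp_lift p (x : 'F_p) : (x : nat)%:Z%:~R = x.
Proof. by rewrite -pmulrn natr_Zp. Qed.

(* Rows of P M beyond the rank vanish mod p when P lifts the inverse of a
   column echelon basis. *)
Lemma dvd_det_corank p k s (M : 'M[int]_k) : prime p ->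
  (\rank (map_mx intr M : 'M['F_p]_k) + s <= k)%N -> (p ^ s %| `|\det M|)%N.
Proof.
move=> p_prime; set Mp := map_mx intr M : 'M['F_p]_k.
set r := \rank Mp => rs.
pose P : 'M[int]_k := map_mx (fun x : 'F_p => (x : nat)%:Z) (invmx (col_ebase Mp)).
have mapP : map_mx intr P = invmx (col_ebase Mp).
  by apply/matrixP => i j; rewrite !mxE Fp_lift.
have detP : coprime (p ^ s) `|\det P|.
  rewrite coprimeXl // prime_coprime // -Fp_intr_eq0 //.
  rewrite -[_%:~R](det_map_mx (intr : {rmorphism int -> 'F_p})) mapP.
  by rewrite -unitfE -unitmxE unitmx_inv col_ebase_unit.
have PM0 (i j : 'I_k) : (r <= i)%N -> (p%:Z %| (P *m M) i j)%Z.
  move=> ri; rewrite dvdzE /= -Fp_intr_eq0 //.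
  have : map_mx intr (P *m M) = pid_mx r *m row_ebase Mp :> 'M['F_p]_k.
    rewrite map_mxM mapP -[map_mx intr M]/Mp -{2}(mulmx_ebase Mp) !mulmxA.
    by rewrite mulVmx ?col_ebase_unit // mul1mx.
  move/matrixP => /(_ i j); rewrite mxE => ->.
  rewrite mxE big1 // => l _; rewrite mxE (leq_gtF ri) andbF mul0r //.
have : (p%:Z ^+ s %| \det (P *m M))%Z.
  apply: rpred_sum => /= sg _; apply: dvdz_mull.
  have sk : (s <= #|[pred i : 'I_k | (r <= i)%N]|)%N.
    have e := cardC [pred i : 'I_k | (r <= i)%N]; rewrite card_ord in e.
    rewrite -(leq_add2l r); apply: leq_trans rs _.
    rewrite -[X in (X <= _)%N]e addnC leq_add2r.
    have rk : (r <= k)%N by exact: rank_leq_row.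
    rewrite -[X in (_ <= X)%N]card_ord -(card_codom (f := widen_ord rk)); last first.
      by move=> x y /(congr1 val) /= /val_inj.
    apply: subset_leq_card; apply/fintype.subsetP => i; rewrite !inE -ltnNge => ir.
    by apply/codomP; exists (Ordinal ir); apply: val_inj.
  apply: dvdz_trans (dvdz_exp2l _ sk) _.
  by apply: dvdz_prod_exp => i ri; apply: PM0.
by rewrite det_mulmx dvdzE abszM abszX absz_nat Gauss_dvdr.
Qed.

(** The length bound allows the factors of f mod p to be indexed by ['I_k.+1]. *)
Lemma irreducible_factor_seq (F : fieldType) (g : {poly F}) : g != 0 ->
  exists gs : seq {poly F}, [/\ (size gs <= (size g).-1)%N,
    forall h, h \in gs -> irreducible_poly h /\ h %| g
    & forall c, ~~ coprimep c g -> exists2 h, h \in gs & h %| c].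
Proof.
have [s] := ubnP (size g); elim: s g => // s IH g sg g0.
have [sg1|sg1] := leqP (size g) 1.
  exists [::]; split => // c.
  have -> : g = (g`_0)%:P by exact: size1_polyC.
  have g00 : g`_0 != 0.
    by apply: contraNneq g0 => g00; rewrite (size1_polyC sg1) g00.
  have u : (g`_0)%:P %= 1 by rewrite polyC_eqp1.
  by rewrite coprimep_sym (eqp_coprimepl _ u) coprime1p.
have [ig|nig] := pselect (irreducible_poly g).
  exists [:: g]; split => [|h|c].
  - by case: (size g) sg1 => [|[]].
  - by rewrite inE => /eqP ->.
  - by rewrite coprimep_sym irreducible_poly_coprime // negbK; exists g; rewrite ?inE.
have [d [sd1 dg ndg]] : exists d : {poly F}, [/\ size d != 1%N, d %| g & ~~ (d %= g)].
  apply/not_existsP => nex; apply: nig; split => // d sd dg.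
  by apply/negPn/negP => ndg; apply: (nex d).
have d0 : d != 0 by apply: contraTneq dg => ->; rewrite dvd0p.
pose e := g %/ d; have gE : g = e * d by rewrite divpK.
have e0 : e != 0 by apply: contraNneq g0 => e0; rewrite gE e0 mul0r.
have se : size g = (size e + size d).-1 by rewrite gE size_mul.
have sd0 : (0 < size d)%N by rewrite size_poly_gt0.
have se0 : (0 < size e)%N by rewrite size_poly_gt0.
have se1 : size e != 1%N.
  apply: contraNneq ndg => se1; rewrite /eqp dg /= gE.
  by rewrite -[X in _ %| X]mul1r dvdp_mul2r // dvdp1 se1.
have [|//|gd [sgd gdP gdc]] := IH d.
  by move: sg se se1 sd1 sd0 se0; move: (size g) (size d) (size e) => a b c; lia.
have [|//|ge [sge geP gec]] := IH e.
  by move: sg se se1 sd1 sd0 se0; move: (size g) (size d) (size e) => a b c; lia.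
exists (gd ++ ge); split.
- rewrite size_cat se; move: sgd sge sd0 se0.
  by move: (size d) (size e) (size gd) (size ge) => a b x y; lia.
- move=> h; rewrite mem_cat => /orP[/gdP|/geP] [ih hd]; split => //.
  + by rewrite gE dvdp_mull.
  + by rewrite gE dvdp_mulr.
- move=> c; rewrite gE coprimepMr negb_and => /orP[/gec|/gdc] [h hin hc].
  + by exists h; rewrite ?mem_cat ?hin ?orbT.
  + by exists h; rewrite ?mem_cat ?hin.
Qed.

Lemma poly_Fp_lift p (g : {poly 'F_p}) : exists G : {poly int}, map_poly intr G = g.
Proof.
exists (map_poly (fun x : 'F_p => (x : nat)%:Z) g); apply/polyP => i.
by rewrite coef_map coef_map_id0 //= Fp_lift.
Qed.

Lemma poly_Fp_eq0 p (P : {poly int}) : prime p -> map_poly intr P = 0 :> {poly 'F_p} ->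
  exists P' : {poly int}, P = p%:Z *: P'.
Proof.
move=> p_prime P0.
have dv i : (p%:Z %| P`_i)%Z.
  by rewrite dvdzE /= -Fp_intr_eq0 // -(coef_map (intr : {rmorphism int -> 'F_p})) P0 coef0.
exists (\poly_(i < size P) (P`_i %/ p%:Z)%Z); apply/polyP => i.
rewrite coefZ coef_poly; case: ltnP => [_|si]; first by rewrite mulrC divzK.
by rewrite mulr0 nth_default.
Qed.

Section NormForm.
Variables (k : nat) (f : {poly int}).
Hypotheses (f_monic : f \is monic) (sf : size f = k.+2) (f_min : coprime_below f).

Definition nrm (c : {poly int}) : int := \det (horner_mx (cmx k f) c).

Lemma nrmM b c : nrm (b * c) = nrm b * nrm c.
Proof. by rewrite /nrm rmorphM -det_mulmx. Qed.

Lemma nrm_modl b c : nrm (b + f * c) = nrm b.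
Proof. by rewrite /nrm rmorphD rmorphM /= horner_cmx_self // mul0r addr0. Qed.

Lemma nrmZ (a : int) c : nrm (a *: c) = a ^+ k.+1 * nrm c.
Proof. by rewrite /nrm linearZ /= detZ. Qed.

Lemma nrm_intr (R : comNzRingType) c :
  (nrm c)%:~R = \det (horner_mx (cmx k (map_poly intr f)) (map_poly intr c)) :> R.
Proof.
rewrite -[_%:~R](det_map_mx (intr : {rmorphism int -> R})) map_horner_mx /=.
by rewrite map_cmx.
Qed.

(** Taking norms in u c + v f = w gives N(u) N(c) = w^(k+1). *)
Lemma nrm_neq0 (c : {poly int}) : c != 0 -> (size c <= k.+1)%N -> nrm c != 0.
Proof.
move=> c0 sc; have [|u [v [w [w0 e]]]] := f_min c0; first by rewrite sf.
have : nrm (u * c + v * f) = w ^+ k.+1.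
  by rewrite e -alg_polyC nrmZ /nrm rmorph1 det1 mulr1.
rewrite [v * f]mulrC nrm_modl nrmM => e'; apply: contraNneq w0 => n0.
by move: e'; rewrite n0 mulr0 => /esym/eqP; rewrite expf_eq0 => /andP[].
Qed.

Section Prime.
Variable p : nat.
Hypotheses (p_prime : prime p).
Let fp : {poly 'F_p} := map_poly intr f.
Hypothesis unram : coprimep fp fp^`().

Let fp_monic : fp \is monic. Proof. exact: monic_map. Qed.

Let size_fp : size fp = k.+2.
Proof. by rewrite /fp size_map_poly_id0 ?sf // (monicP f_monic) oner_eq0. Qed.

Lemma dvd_nrm g c : g %| fp -> g %| map_poly intr c -> (p ^ (size g).-1 %| `|nrm c|)%N.
Proof.
move=> gf gc; apply: dvd_det_corank => //.
rewrite map_horner_mx map_cmx; apply: rank_horner_cmx gf gc => //.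
Qed.

Lemma coprime_nrm c : coprimep (map_poly intr c) fp -> ~~ (p %| `|nrm c|)%N.
Proof.
move=> /Bezout_eq1_coprimepP[[u v] /= e]; rewrite -Fp_intr_eq0 // nrm_intr.
have := congr1 (fun h => \det (horner_mx (cmx k fp) h)) e.
rewrite rmorphD !rmorphM /= horner_cmx_self // mulr0 addr0 rmorph1.
rewrite -[_ * _]/(_ *m _) det_mulmx det1 => e1.
by apply/negP => /eqP n0; move: e1; rewrite n0 mulr0 => /esym/eqP; rewrite oner_eq0.
Qed.

(* Adjusting the lifts of g and fp / g so that G H = f + p U with U = 1 mod p
   makes the product of the two norms an exact power of p. *)
Lemma cofactor_exists g : irreducible_poly g -> g %| fp ->
  exists H : {poly int},
  [/\ forall c, g %| map_poly intr c ->
        exists c' c'', c * H = p%:Z *: c' + f * c'',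
      nrm H != 0 & logn p `|nrm H| = (k.+1 - (size g).-1)%N].
Proof.
move=> ig gf; set h := fp %/ g.
have hg : fp = h * g by rewrite divpK.
(* f mod p is squarefree, so the irreducible g cannot divide its own cofactor. *)
have cgh : coprimep g h.
  rewrite irreducible_poly_coprime //; apply/negP => gh.
  have gd : g %| fp^`().
    by rewrite hg derivM dvdp_add //; [exact: dvdp_mull | exact: dvdp_mulr].
  have := dvdp_gcd g fp fp^`(); rewrite gf gd /= => g1.
  move: unram; rewrite coprimep_def => /eqP u1.
  have := dvdp_leq _ g1; rewrite -size_poly_eq0 u1 => /(_ isT) sg.
  by case: ig => /leq_trans/(_ sg).
have [[u v] /= uv] := Bezout_eq1_coprimepP _ _ cgh.
have [G0 G0E] := poly_Fp_lift g; have [H0 H0E] := poly_Fp_lift h.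
have [E0 E0E] : exists E0, f - G0 * H0 = p%:Z *: E0.
  apply: (poly_Fp_eq0 p_prime).
  by rewrite rmorphB rmorphM /= G0E H0E -/fp hg mulrC subrr.
pose e0 : {poly 'F_p} := map_poly intr E0.
(* K and L solve G0 K + H0 L = 1 + E0 mod p, so that the error E0 of the first lifts is traded for U
   = 1 mod p. *)
have [K KE] := poly_Fp_lift (u * (1 + e0)).
have [L LE] := poly_Fp_lift (v * (1 + e0)).
pose G := G0 + p%:Z *: L; pose H := H0 + p%:Z *: K.
pose U := G0 * K + H0 * L + p%:Z *: (L * K) - E0.
have pF0 : (p%:Z)%:~R = 0 :> 'F_p.
  by apply/eqP; rewrite Fp_intr_eq0 // absz_nat.
have UE : map_poly intr U = 1 :> {poly 'F_p}.
  rewrite /U rmorphB !rmorphD /= map_polyZ /= pF0 scale0r addr0.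
  rewrite !rmorphM /= G0E H0E KE LE -/e0.
  have -> : g * (u * (1 + e0)) + h * (v * (1 + e0)) = (u * g + v * h) * (1 + e0) by ring.
  by rewrite uv mul1r addrK.
have GH : G * H = p%:Z *: U + f * 1.
  have -> : f = G0 * H0 + p%:Z *: E0 by rewrite -E0E addrC subrK.
  rewrite /G /H /U -!mul_polyC; ring.
have GE : map_poly intr G = g.
  by rewrite /G rmorphD /= map_polyZ /= pF0 scale0r addr0.
have HE : map_poly intr H = h.
  by rewrite /H rmorphD /= map_polyZ /= pF0 scale0r addr0.
have nU : ~~ (p %| `|nrm U|)%N.
  by apply: coprime_nrm; rewrite UE coprime1p.
have nU0 : nrm U != 0 by apply: contraNneq nU => ->; rewrite absz0 dvdn0.
have nGH : (`|nrm G| * `|nrm H| = p ^ k.+1 * `|nrm U|)%N.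
  by rewrite -abszM -nrmM GH nrm_modl nrmZ abszM abszX absz_nat.
have p0 := prime_gt0 p_prime.
have [nG0 nH0] : (0 < `|nrm G|)%N /\ (0 < `|nrm H|)%N.
  by apply/andP; rewrite -muln_gt0 nGH muln_gt0 expn_gt0 p0 absz_gt0.
(* The two valuations add up to k+1 and are at least deg g and deg h, which also add up to k+1; both
   bounds are therefore equalities. *)
have lgt : (logn p `|nrm G| + logn p `|nrm H| = k.+1)%N.
  rewrite -lognM // nGH lognM ?expn_gt0 ?p0 ?absz_gt0 //.
  rewrite pfactorK // (lognE p `|nrm U|) p_prime absz_gt0 nU0 /=.
  by rewrite (negPf nU) addn0.
have hf : h %| fp by rewrite hg dvdp_mulr.
have lG : ((size g).-1 <= logn p `|nrm G|)%N.
  by rewrite -pfactor_dvdn //; apply: dvd_nrm; rewrite ?GE.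
have lH : ((size h).-1 <= logn p `|nrm H|)%N.
  by rewrite -pfactor_dvdn //; apply: dvd_nrm; rewrite ?HE.
have fp0 := monic_neq0 fp_monic.
have g0 : g != 0 by exact: irredp_neq0.
have sgh : (size h).-1 = (k.+1 - (size g).-1)%N.
  rewrite /h size_divp // size_fp.
  have : (size g <= size fp)%N by exact: dvdp_leq.
  move: g0; rewrite -size_poly_gt0 size_fp.
  by move: (size g) => a; lia.
exists H; split.
- move=> c gc.
  have [q qE] := poly_Fp_lift (map_poly intr c %/ g).
  have [c' c'E] : exists c', c * H - f * q = p%:Z *: c'.
    apply: (poly_Fp_eq0 p_prime).
    rewrite rmorphB !rmorphM /= HE -/fp hg qE.
    by rewrite -[X in X * h](divpK gc); apply/eqP; rewrite subr_eq0; apply/eqP; ring.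
  by exists c', q; rewrite -c'E subrK.
- by rewrite -absz_gt0.
- move: lgt lG lH; rewrite sgh.
  by move: (logn p `|nrm G|) (logn p `|nrm H|) (size g).-1 => a b c; lia.
Qed.

End Prime.
End NormForm.

(** * Divisibility of norms by powers of a prime *)

Section PowerClasses.
Variables (k : nat) (f : {poly int}).
Hypotheses (f_monic : f \is monic) (sf : size f = k.+2).
Variable p : nat.
Hypotheses (p_prime : prime p).
Let fp : {poly 'F_p} := map_poly intr f.
Hypothesis unram : coprimep fp fp^`().

Let fp0 : fp != 0. Proof. by rewrite monic_neq0 // monic_map. Qed.

Let size_fp : size fp = k.+2.
Proof. by rewrite /fp size_map_poly_id0 ?sf // (monicP f_monic) oner_eq0. Qed.

(* The classes of level j are indexed by words of irreducible factors of f
   mod p: removing one factor g from c means c H = p c', with H the cofactor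
   of g, and this lowers the valuation of the norm by exactly deg g. *)
Lemma power_classes j : exists cls : j.-tuple 'I_k.+1 -> {poly int} -> Prop,
  [/\ forall s b c, cls s b -> cls s c -> cls s (b - c),
      forall s c, cls s c -> (p ^ j %| `|nrm k f c|)%N
    & forall c, nrm k f c != 0 -> (p ^ j %| `|nrm k f c|)%N -> exists s, cls s c].
Proof.
have [gs [sgs gsP gsC]] := irreducible_factor_seq fp0.
have /choice[H HP] : forall g : {poly 'F_p}, exists H : {poly int}, g \in gs ->
    [/\ forall c, g %| map_poly intr c ->
        exists c' c'', c * H = p%:Z *: c' + f * c'',
      nrm k f H != 0 & logn p `|nrm k f H| = (k.+1 - (size g).-1)%N].
  move=> g; case: (boolP (g \in gs)) => [/gsP[ig gf]|_]; last by exists 0.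
  by have [H] := cofactor_exists f_monic sf p_prime unram ig gf; exists H.
pose gn (i : nat) := nth (0 : {poly 'F_p}) gs i.
(* l is the valuation still to be found. The subtraction is truncated, so a last factor may
   overshoot; at l = 0 every c is accepted and the rest of the word is padding. *)
pose fix J (s : seq 'I_k.+1) (l : nat) (c : {poly int}) {struct s} : Prop :=
  l = 0%N \/ if s is i :: s' then
    (i < size gs)%N /\ exists c' c'', c * H (gn i) = p%:Z *: c' + f * c'' /\
      J s' (l - (size (gn i)).-1)%N c'
  else False.
have degk g : g \in gs -> ((size g).-1 <= k.+1)%N.
  by move=> /gsP[_ /(dvdp_leq fp0)]; rewrite size_fp; case: (size g).
have step i c c' c'' : (i < size gs)%N -> c * H (gn i) = p%:Z *: c' + f * c'' ->
    (`|nrm k f c| * `|nrm k f (H (gn i))| = p ^ k.+1 * `|nrm k f c'|)%N.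
  move=> igs e; rewrite -abszM -nrmM e nrm_modl // nrmZ abszM abszX.
  by rewrite absz_nat.
exists (fun s c => J s j c); split.
- move=> [s _] /=; elim: s j => [|i s IH] l b c /=.
    by move=> [-> _|//]; left.
  move=> [->|[igs [b' [b'' [be bJ]]]]]; first by left.
  move=> [l0|[_ [c' [c'' [ce cJ]]]]]; first by left.
  right; split => //; exists (b' - c'), (b'' - c''); split; last exact: IH.
  by rewrite mulrBl be ce scalerBr; ring.
- move=> [s _] /=; elim: s j => [|i s IH] l c /=.
    by move=> [-> //|//]; rewrite expn0 dvd1n.
  move=> [->|[igs [c' [c'' [e /IH dv]]]]]; first by rewrite expn0 dvd1n.
  have [c0|c0] := eqVneq (nrm k f c) 0; first by rewrite c0 absz0 dvdn0.
  have [_ h0 hl] := HP _ (mem_nth 0 igs).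
  have := step _ _ _ _ igs e => ee.
  have p0 := prime_gt0 p_prime.
  have c'0 : nrm k f c' != 0.
    rewrite -absz_gt0; have : (0 < p ^ k.+1 * `|nrm k f c'|)%N by rewrite -ee muln_gt0 !absz_gt0 c0.
    by rewrite muln_gt0 => /andP[].
  move: dv; rewrite !pfactor_dvdn ?absz_gt0 //.
  have := congr1 (logn p) ee; rewrite !lognM ?absz_gt0 ?expn_gt0 ?p0 //.
  rewrite pfactorK // hl; have := degk _ (mem_nth 0 igs).
  by move: (size (gn i)).-1 (logn p `|nrm k f c|) (logn p `|nrm k f c'|) => a x y; lia.
- suff : forall n l c, (l <= n)%N -> nrm k f c != 0 -> (p ^ l %| `|nrm k f c|)%N ->
      exists s : n.-tuple 'I_k.+1, J s l c.
    by move=> main c c0 dv; have [s] := main j j c (leqnn j) c0 dv; exists s.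
  elim=> [|n IH] l c ln c0 dv.
    by exists [tuple]; left; case: l ln {dv}.
  have [->|l0] := posnP l.
    by exists (nseq_tuple n.+1 ord0); left.
  have pc : (p %| `|nrm k f c|)%N by apply: dvdn_trans dv; rewrite dvdn_exp.
  have ncop : ~~ coprimep (map_poly intr c) fp.
    by apply: contraL pc => cop; apply: coprime_nrm.
  have [g gin gc] := gsC _ ncop.
  have [hc h0 hl] := HP _ gin; have [c' [c'' e]] := hc _ gc.
  have igs : (index g gs < size gs)%N by rewrite index_mem.
  have ik : (index g gs < k.+1)%N by apply: leq_trans igs _; rewrite (leq_trans sgs) ?size_fp.
  have gE : gn (index g gs) = g by rewrite /gn nth_index.
  have := step (index g gs) c c' c'' igs; rewrite gE => /(_ e) ee.
  have p0 := prime_gt0 p_prime.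
  have c'0 : nrm k f c' != 0.
    rewrite -absz_gt0; have : (0 < p ^ k.+1 * `|nrm k f c'|)%N.
      by rewrite -ee muln_gt0 !absz_gt0 c0.
    by rewrite muln_gt0 => /andP[].
  have [ig _] := gsP _ gin.
  have sg : (1 < size g)%N by case: ig.
  have [||s sJ] := IH (l - (size g).-1)%N c' _ c'0.
  - by move: ln sg l0; move: (size g) => a; lia.
  - move: dv; rewrite !pfactor_dvdn ?absz_gt0 //.
    have := congr1 (logn p) ee; rewrite !lognM ?absz_gt0 ?expn_gt0 ?p0 //.
    rewrite pfactorK // hl; have := degk _ gin.
    by move: (size g).-1 (logn p `|nrm k f c|) (logn p `|nrm k f c'|) => a x y; lia.
  exists (cons_tuple (Ordinal ik) s); right; split => //.
  by exists c', c''; rewrite gE.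
Qed.

Definition common_roots (c : {poly int}) : pred 'F_p :=
  [pred rho | root fp rho && root (map_poly intr c) rho].

(** The product of the x - rho over the common roots divides both f and c mod p, so its degree
    bounds the valuation from below. *)
Lemma card_common_roots c : nrm k f c != 0 ->
  (#|common_roots c| <= logn p `|nrm k f c|)%N.
Proof.
move=> c0; rewrite -pfactor_dvdn ?absz_gt0 //.
pose g : {poly 'F_p} := \prod_(rho <- enum (common_roots c)) ('X - rho%:P).
have sg : (size g).-1 = #|common_roots c| by rewrite size_prod_XsubC cardE.
rewrite -sg; apply: dvd_nrm => //; apply: uniq_roots_dvdp.
- by apply/allP => r; rewrite mem_enum => /andP[].
- by rewrite uniq_rootsE enum_uniq.
- by apply/allP => r; rewrite mem_enum => /andP[].
- by rewrite uniq_rootsE enum_uniq.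
Qed.

(** A valuation v >= 2 is at most 2 (v - 1). If v = 1, some irreducible factor of f mod p divides c
    and has degree at most v, so it is linear and gives a root. *)
Lemma logn_nrm_le c : nrm k f c != 0 ->
  (logn p `|nrm k f c| <= #|common_roots c| + 2 * (logn p `|nrm k f c| - 1))%N.
Proof.
move=> c0; suff : logn p `|nrm k f c| = 1%N -> (0 < #|common_roots c|)%N.
  by move: (logn _ _) #|_| => v r; lia.
move=> l1; have [gs [_ gsP gsC]] := irreducible_factor_seq fp0.
have [|g gin gc] := gsC (map_poly intr c).
  apply/negP => cop; have := coprime_nrm f_monic sf p_prime cop.
  have : (p ^ 1 %| `|nrm k f c|)%N by rewrite pfactor_dvdn ?absz_gt0 // l1.
  by rewrite expn1 => ->.
have [ig gf] := gsP _ gin.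
have := dvd_nrm f_monic sf p_prime gf gc; rewrite pfactor_dvdn ?absz_gt0 // l1 => sg.
have [r rg] : {r | root g r}.
  apply: poly2_root; case: ig sg => + _.
  by move: (size g) => a; lia.
apply/card_gt0P; exists r; rewrite inE /= -!dvdp_XsubCl in rg *.
by rewrite (dvdp_trans rg gf) (dvdp_trans rg gc).
Qed.

End PowerClasses.

(** * Lattice points in boxes *)

Lemma prod_sub_le (R : numDomainType) n (a b : 'I_n -> R) (e M : R) : 0 <= M ->
  (forall i, `|a i| <= M) -> (forall i, `|b i| <= M) -> (forall i, `|a i - b i| <= e) ->
  `|\prod_i a i - \prod_i b i| <= n%:R * e * M ^+ n.-1.
Proof.
move=> M0; elim: n a b => [|n IH] a b aM bM ab.
  by rewrite !big_ord0 subrr normr0 !mul0r.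
have e0 : 0 <= e by apply: le_trans (ab ord0).
rewrite !big_ord_recl.
set A := \prod_(i < n) a _; set B := \prod_(i < n) b _.
have -> : a ord0 * A - b ord0 * B = a ord0 * (A - B) + (a ord0 - b ord0) * B by ring.
apply: le_trans (ler_normD _ _) _; rewrite !normrM.
have BM : `|B| <= M ^+ n.
  rewrite normr_prod -[X in M ^+ X]card_ord -prodr_const.
  by apply: ler_prod => i _; rewrite normr_ge0 bM.
have -> : n.+1%:R * e * M ^+ n.+1.-1 = M * (n%:R * e * M ^+ n.-1) + e * M ^+ n.
  rewrite -natr1; case: n {IH a b aM bM ab A B BM} => [|n] /=.
    by rewrite expr0; ring.
  by rewrite !exprS; ring.
apply: lerD; last by apply: ler_pM.
by apply: ler_pM => //; apply: IH.
Qed.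

Lemma det_le (R : numDomainType) n (A : 'M[R]_n) (B : R) :
  (forall i j, `|A i j| <= B) -> `|\det A| <= n`!%:R * B ^+ n.
Proof.
move=> AB; apply: le_trans (ler_norm_sum _ _ _) _.
have -> : n`!%:R * B ^+ n = \sum_(s : 'S_n) B ^+ n.
  by rewrite big_const iter_addr_0 card_Sn mulr_natl.
apply: ler_sum => s _; rewrite normrM normrX normrN1 expr1n mul1r normr_prod.
rewrite -[X in _ <= _ ^+ X]card_ord -prodr_const; apply: ler_prod => i _.
by rewrite normr_ge0 AB.
Qed.

Lemma det_scalar_add_le (R : numDomainType) n (A : 'M[R]_n) (z B : R) : 0 <= z ->
  0 <= B -> (forall i j, `|A i j| <= B) ->
  `|\det (z%:M + A) - z ^+ n| <= n`!%:R * (n%:R * B * (z + B) ^+ n.-1).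
Proof.
move=> z0 B0 AB; rewrite -det_scalar /determinant -sumrB.
apply: le_trans (ler_norm_sum _ _ _) _.
have -> : n`!%:R * (n%:R * B * (z + B) ^+ n.-1)
    = \sum_(s : 'S_n) (n%:R * B * (z + B) ^+ n.-1).
  by rewrite big_const iter_addr_0 card_Sn mulr_natl.
apply: ler_sum => s _; rewrite -mulrBr normrM normrX normrN1 expr1n mul1r.
have zb i j : `|(z%:M : 'M[R]_n) i j| <= z.
  by rewrite mxE; case: eqP; rewrite ?mulr1n ?mulr0n ?normr0 // ger0_norm.
apply: prod_sub_le => [|i|i|i].
- exact: addr_ge0.
- by rewrite mxE; apply: le_trans (ler_normD _ _) _; apply: lerD.
- by apply: le_trans (zb _ _) _; rewrite lerDl.
- by rewrite mxE addrAC subrr add0r.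
Qed.

Section Covering.
Variables (k : nat) (f : {poly int}).
Hypotheses (f_monic : f \is monic) (sf : size f = k.+2) (f_min : coprime_below f).

Let n := k.+1.

(** A crude constant that turns a bound on the coefficients of c into a bound on the entries of
    c(T). *)
Definition entry_bound : nat :=
  \sum_(l < k.+1) \sum_i \sum_j `|(cmx k f ^+ l) i j|%N.

Let tau := entry_bound.

Lemma horner_cmx_entry_le (v : 'rV[int]_n) (B : nat) i j :
  (forall l, `|v 0%R l|%N <= B)%N ->
  (`|horner_mx (cmx k f) (rVpoly v) i j| <= (B * tau)%N :> int).
Proof.
move=> vB; have sv : (size (rVpoly v) <= n)%N by exact: size_poly.
rewrite (horner_mx_sum _ sv) summxE.
apply: le_trans (ler_norm_sum _ _ _) _.
rewrite /tau /entry_bound big_distrr /= (big_morph Posz PoszD (erefl 0%:Z)).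
apply: ler_sum => l _; rewrite mxE normrM PoszM.
apply: ler_pM => //.
  by rewrite coef_rVpoly_ord -abszE lez_nat vB.
rewrite -abszE lez_nat (bigD1 i) //= (bigD1 j) //=.
by rewrite -addnA leq_addr.
Qed.

Definition nrm_bound : nat := n`! * tau ^ n.

Lemma nrm_le (v : 'rV[int]_n) (B : nat) : (forall l, `|v 0%R l|%N <= B)%N ->
  (`|nrm k f (rVpoly v)| <= nrm_bound * B ^ n)%N.
Proof.
move=> vB; have := det_le (fun i j => horner_cmx_entry_le i j vB).
rewrite -[X in X ^+ _]natz -natrX -natrM natz -/(nrm k f _) -abszE lez_nat.
by rewrite expnMn mulnCA mulnC.
Qed.

Lemma vandermonde_eval (p : nat) (rho : 'F_p) (v : 'rV[int]_n) :
  (map_poly intr (rVpoly v)).[rho] =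
  (map_mx intr v *m \col_i rho ^+ i) 0 0.
Proof.
rewrite (horner_coef_wide (n := n)); last first.
  by apply: leq_trans (size_poly _ _) _; exact: size_poly.
rewrite mxE; apply: eq_bigr => i _; rewrite !mxE coef_map coef_rVpoly_ord //.
Qed.

(* The ideal of c with c(rho) = 0 contains b(T) Z^n for a small b found by
   pigeonhole; reducing modulo this sublattice gives small representatives. *)
Lemma small_representative (p t : nat) (rho u : 'F_p) : prime p ->
  (p < t.+1 ^ n)%N -> root (map_poly intr f) rho ->
  exists2 v : 'rV[int]_n, (forall i, `|v 0%R i| <= n * tau * t)%N &
    (map_poly intr (rVpoly v)).[rho] = u.
Proof.
move=> p_prime pt frho.
pose bp (c : {ffun 'I_n -> 'I_t.+1}) : 'rV[int]_n := \row_i (c i : nat)%:Z.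
pose ev (c : {ffun 'I_n -> 'I_t.+1}) : 'F_p := (map_poly intr (rVpoly (bp c))).[rho].
have /injectivePn[c [c' cc' evc]] : ~~ injectiveb ev.
  apply/injectiveP => /leq_card; rewrite card_ffun card_Fp // !card_ord.
  by rewrite leqNgt pt.
pose b := bp c - bp c'.
have b_small i : (`|b 0%R i| <= t)%N.
  by rewrite /b !mxE; have := ltn_ord (c i); have := ltn_ord (c' i);
  move: (nat_of_ord (c i)) (nat_of_ord (c' i)) => x y; clear; lia.
have b0 : b != 0.
  apply: contraNneq cc' => /eqP; rewrite subr_eq0 => /eqP/rowP bb.
  by apply/eqP/ffunP => i; have := bb i; rewrite !mxE => -[/val_inj].
have bpoly0 : rVpoly b != 0.
  by apply: contraNneq b0 => e; rewrite -[b]rVpolyK e linear0.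
have brho : (map_poly intr (rVpoly b)).[rho] = 0 :> 'F_p.
  by rewrite /b linearB rmorphB hornerD hornerN /= -/(ev c) -/(ev c') evc subrr.
pose M := horner_mx (cmx k f) (rVpoly b).
have D0 : \det M != 0 by apply: nrm_neq0 => //; exact: size_poly.
pose y : 'rV[int]_n := (u : nat)%:Z *: delta_mx 0 0.
(* q is the integer part of y M^-1, computed through the adjugate to stay over Z. Then det M times v
   is r M with remainders 0 <= r < |det M|, so v is at most n times the entry bound of M. *)
pose Y := y *m \adj M.
pose q : 'rV[int]_n := \row_i (Y 0%R i %/ \det M)%Z.
pose v := y - q *m M.
exists v; last first.
  rewrite vandermonde_eval /v map_mxB mulmxBl map_mxM -mulmxA.
  have -> : map_mx intr M *m \col_i rho ^+ i = 0.
    rewrite /M map_horner_mx map_cmx horner_cmx_eigenvector ?monic_map //.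
      by rewrite brho scale0r.
    by rewrite size_map_poly_id0 ?sf // (monicP f_monic) oner_eq0.
  rewrite mulmx0 subr0 /y map_mxZ map_delta_mx /= -scalemxAl -rowE !mxE.
  by rewrite Fp_lift expr0 mulr1.
move=> j; pose r : 'rV[int]_n := \row_i (Y 0%R i %% \det M)%Z.
have rM : \det M *: v = r *m M.
  have -> : r = Y - \det M *: q.
    apply/rowP => i; rewrite !mxE [X in _ = X - _](divz_eq _ (\det M)).
    by rewrite [(_ %/ _)%Z * _]mulrC addrAC subrr add0r.
  by rewrite mulmxBl /Y -mulmxA mul_adj_mx -(scalemxAl _ q) /v scalerBr mul_mx_scalar.
have : `|(\det M *: v) 0 j| <= `|\det M| * (n * tau * t)%N%:Z.
  rewrite rM mxE; apply: le_trans (ler_norm_sum _ _ _) _.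
  have -> : `|\det M| * (n * tau * t)%N%:Z = \sum_(i < n) `|\det M| * (t * tau)%N%:Z.
    by rewrite sumr_const card_ord -mulr_natl -mulnA mulnC [in RHS]mulnC natz PoszM; ring.
  apply: ler_sum => i _; rewrite normrM; apply: ler_pM => //; last first.
    exact: horner_cmx_entry_le.
  by rewrite mxE ger0_norm ?modz_ge0 //; apply/ltW/ltz_mod.
by rewrite mxE normrM ler_pM2l ?normr_gt0 // -abszE lez_nat.
Qed.

End Covering.

Lemma card_fibers (T U : finType) (F : T -> U) :
  (\sum_(u : U) #|[pred c | F c == u]|)%N = #|T|.
Proof.
rewrite -sum1_card (partition_big F predT) //=; apply: eq_bigr => u _.
by rewrite sum1_card; apply: eq_card => c; rewrite !inE.
Qed.

(** For the least h with M <= C0 h^(k+1), a cell of side h contains at most one point of A, since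
    two would differ by at most h-1 in each coordinate. There are (X/h + 1)^(k+1) cells, and h <= C1
    X. *)
Lemma separated_card k X C0 C1 M (A : pred {ffun 'I_k.+1 -> 'I_X}) :
  (0 < C0)%N -> (0 < X)%N -> (0 < M)%N ->
  (forall a, A a -> (M <= (C1 * X) ^ k.+1)%N) ->
  (forall a b h, A a -> A b -> a != b ->
    (forall i, (a i <= b i + h)%N && (b i <= a i + h)%N) -> (M <= C0 * h ^ k.+1)%N) ->
  (#|A| * M <= C0 * (C1.+1 * X) ^ k.+1)%N.
Proof.
move=> C0_gt0 X_gt0 M_gt0 MX sep.
have [a0 Aa0|A0] := pickP A; last by rewrite eq_card0 ?mul0n.
have exh : exists h, (M <= C0 * h ^ k.+1)%N.
  exists M; apply: leq_trans (leq_pmull _ C0_gt0).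
  by rewrite expnS leq_pmulr // expn_gt0 M_gt0.
case: (ex_minnP exh) => h Mh hmin.
have h_gt0 : (0 < h)%N by case: h Mh {hmin} => //; rewrite exp0n // muln0 leqNgt M_gt0.
have hX : (h <= C1 * X)%N.
  by apply: hmin; apply: leq_trans (MX _ Aa0) _; rewrite leq_pmull.
pose cell (c : {ffun 'I_k.+1 -> 'I_X}) : {ffun 'I_k.+1 -> 'I_(X %/ h).+1} :=
  [ffun i => inord (c i %/ h)].
have cell_inj : {in A &, injective cell}.
  move=> a b Aa Ab ab; apply/eqP/negPn/negP => nab.
  have := sep a b h.-1 Aa Ab nab; rewrite leqNgt => imp.
  suff : ~~ (C0 * h.-1 ^ k.+1 < M)%N.
    by rewrite -leqNgt => /hmin; rewrite leqNgt prednK // leqnn.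
  apply: imp => i; move/ffunP/(_ i)/(congr1 val): ab.
  rewrite !ffunE /= !inordK ?ltnS ?leq_div2r //; try exact/ltnW.
  move=> e; have := divn_eq (a i) h; have := divn_eq (b i) h; rewrite e.
  have := ltn_pmod (a i) h_gt0; have := ltn_pmod (b i) h_gt0.
  by move: (_ * h)%N (_ %% h)%N (_ %% h)%N => x y z; lia.
have cA : (#|A| <= (X %/ h).+1 ^ k.+1)%N.
  rewrite -(card_in_image cell_inj); apply: leq_trans (max_card _) _.
  by rewrite card_ffun !card_ord.
apply: leq_trans (leq_mul cA Mh) _.
rewrite mulnCA leq_mul2l -expnMn leq_exp2r // orbC; apply/orP; left.
by rewrite !mulSn [(h + _)%N]addnC leq_add // leq_trunc_div.
Qed.

(** * Counting box points by residues and norms *)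

Section Boxes.
Variables (k : nat) (f : {poly int}).
Hypotheses (f_monic : f \is monic) (sf : size f = k.+2) (f_min : coprime_below f).

Let n := k.+1.
Let tau := entry_bound k f.

Definition brow X (c : {ffun 'I_n -> 'I_X}) : 'rV[int]_n := \row_i (c i : nat)%:Z.

Definition fiber_count p X (rho u : 'F_p) : nat :=
  #|[pred c : {ffun 'I_n -> 'I_X} | (map_poly intr (rVpoly (brow c))).[rho] == u]|.

(** Translation by a vector v with entries at most D = n tau t changes the value at [rho] as
    desired; a further shift by D in every coordinate keeps the point nonnegative, whence the
    widening by 2D. *)
Lemma fiber_count_shift p t X (rho u u' : 'F_p) : prime p ->
  (p < t.+1 ^ n)%N -> root (map_poly intr f) rho ->
  (fiber_count X rho u <= fiber_count (X + 2 * (n * tau * t)) rho u')%N.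
Proof.
move=> p_prime pt frho; set D := (n * tau * t)%N.
pose ev (v : 'rV[int]_n) : 'F_p := (map_poly intr (rVpoly v)).[rho].
have evD v w : ev (v + w) = ev v + ev w.
  by rewrite /ev linearD rmorphD hornerD.
have [v vD vE] := small_representative f_monic sf f_min (u' - u - ev (\row_i D%:Z))
  p_prime pt frho.
have lt (c : {ffun 'I_n -> 'I_X}) i : (`|((c i : nat)%:Z + v 0 i + D%:Z)%R| < X + 2 * D)%N.
  have := ltn_ord (c i); have := vD i; rewrite -/tau -/D.
  by move: (nat_of_ord _) (v 0 i) => a b; clear; lia.
pose sh (c : {ffun 'I_n -> 'I_X}) : {ffun 'I_n -> 'I_(X + 2 * D)} :=
  [ffun i => Ordinal (lt c i)].
have shE c : brow (sh c) = brow c + v + \row_i D%:Z.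
  apply/rowP => i; rewrite !mxE ffunE /= gez0_abs //.
  by have := vD i; rewrite -/tau -/D; move: (nat_of_ord _) (v 0 i) => a b; clear; lia.
have sh_inj : injective sh.
  move=> a b ab; have : brow a = brow b.
    by apply: (addIr v); apply: (addIr (\row_i D%:Z)); rewrite -!shE ab.
  by move=> /rowP e; apply/ffunP => i; have := e i; rewrite !mxE => -[/val_inj].
rewrite /fiber_count -(fintype.card_image sh_inj).
apply: subset_leq_card; apply/fintype.subsetP => y.
move=> /fintype.imageP[c + ->]; rewrite !inE => /eqP ec.
rewrite shE -/(ev _) !evD; have -> : ev (brow c) = u by [].
have -> : ev v = u' - u - ev (\row_i D%:Z) by [].
by apply/eqP; ring.
Qed.

Lemma sum_fiber_count p X (rho : 'F_p) :
  (\sum_(u : 'F_p) fiber_count X rho u)%N = (X ^ n)%N.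
Proof. by rewrite card_fibers card_ffun !card_ord. Qed.

(** One fiber is compared with each of the p fibers of the larger box, which partition it. *)
Lemma fiber_count_ub p t X (rho u : 'F_p) : prime p ->
  (p < t.+1 ^ n)%N -> root (map_poly intr f) rho ->
  (p * fiber_count X rho u <= (X + 2 * (n * tau * t)) ^ n)%N.
Proof.
move=> p_prime pt frho; rewrite -(sum_fiber_count _ rho).
have -> F : (p * F = \sum_(u' : 'F_p) F)%N by rewrite sum_nat_const card_Fp.
by apply: leq_sum => u' _; apply: fiber_count_shift.
Qed.

Lemma fiber_count_lb p t X (rho u : 'F_p) : prime p ->
  (p < t.+1 ^ n)%N -> root (map_poly intr f) rho ->
  (X ^ n <= p * fiber_count (X + 2 * (n * tau * t)) rho u)%N.
Proof.
move=> p_prime pt frho; rewrite -(sum_fiber_count _ rho).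
have -> F : (p * F = \sum_(u' : 'F_p) F)%N by rewrite sum_nat_const card_Fp.
by apply: leq_sum => u' _; apply: fiber_count_shift.
Qed.

Variable Q : nat.
Hypothesis Q_gt0 : (0 < Q)%N.

(** The product is what makes the determinant deviate from its scalar part by at most half of it;
    the summand 2 keeps the center at least 2X. *)
Let K := (2 ^ n * n`! * n * tau + 2)%N.

Definition center X : nat := (1 + Q * K * X)%N.

(* The norms of these elements are all comparable to X^n because the center
   dominates, and they are prime to Q. *)
Definition belt X (c : {ffun 'I_n -> 'I_X}) : {poly int} :=
  (center X)%:Z%:P + Q%:Z *: rVpoly (brow c).

Definition belt_bound : nat := (2 * (1 + Q * K))%N.

Lemma brow_le X (c : {ffun 'I_n -> 'I_X}) l : (`|brow c 0%R l| <= X)%N.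
Proof. by rewrite mxE absz_nat ltnW. Qed.

Lemma nrm_belt X (c : {ffun 'I_n -> 'I_X}) :
  (2 * `|nrm k f (belt c) - (center X ^ n)%:Z| <= center X ^ n)%N.
Proof.
pose B := (Q * (X * tau))%N; pose z := center X.
pose A := Q%:Z *: horner_mx (cmx k f) (rVpoly (brow c)).
have AB i j : `|A i j| <= B%:Z.
  rewrite mxE normrM PoszM; apply: ler_pM => //.
  exact: horner_cmx_entry_le (brow_le c).
have nE : nrm k f (belt c) = \det (z%:Z%:M + A).
  by rewrite /nrm /belt rmorphD /= horner_mx_C linearZ.
have := det_scalar_add_le (z := z%:Z) isT (isT : 0 <= B%:Z) AB.
have -> : n`!%:R * (n%:R * B%:Z * (z%:Z + B%:Z) ^+ n.-1)
    = (n`! * (n * B * (z + B) ^ n.-1))%N%:Z.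
  by rewrite !PoszM -PoszD -[(z + B)%N%:Z in LHS]natz -natrX !natz.
rewrite -nE -[X in X ^+ _]natz -natrX natz -abszE lez_nat => le.
apply: leq_trans (leq_mul (leqnn 2) le) _.
have KB : (2 ^ n * n`! * n * B <= z)%N.
  apply: (@leq_trans (Q * K * X)%N); last exact: leq_addl.
  have -> : (2 ^ n * n`! * n * B = Q * (2 ^ n * n`! * n * tau) * X)%N by rewrite /B; ring.
  by rewrite leq_mul2r leq_mul2l leq_addr !orbT.
have Bz : (B <= z)%N.
  by apply: leq_trans KB; rewrite leq_pmull // !muln_gt0 expn_gt0 fact_gt0.
have zB : ((z + B) ^ k <= 2 ^ k * z ^ k)%N.
  rewrite -expnMn; case: (k) => // l; rewrite leq_exp2r // mul2n -addnn.
  by rewrite leq_add2l.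
apply: (@leq_trans (2 * (n`! * (n * B * (2 ^ k * z ^ k))))%N).
  by rewrite !leq_mul2l zB !orbT.
have -> : (2 * (n`! * (n * B * (2 ^ k * z ^ k))) = 2 ^ n * n`! * n * B * z ^ k)%N.
  by rewrite /n [in RHS]expnS; ring.
by rewrite [(center X ^ _)%N]expnS leq_mul2r KB orbT.
Qed.

Lemma center_gt X : (0 < X)%N -> (2 * X <= center X <= (1 + Q * K) * X)%N.
Proof.
move=> X0; apply/andP; split.
  apply: leq_trans (leq_addl _ _); rewrite leq_mul2r.
  by rewrite /K mulnDr; apply/orP; right; apply: leq_trans (leq_addl _ _); rewrite leq_pmull.
by rewrite mulnDl mul1n leq_add2r.
Qed.

Lemma nrm_belt_neq0 X (c : {ffun 'I_n -> 'I_X}) : nrm k f (belt c) != 0.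
Proof.
have := nrm_belt c; have : (0 < center X ^ n)%N by rewrite expn_gt0.
by move: (center X ^ n)%N (nrm _ _ _) => a b; lia.
Qed.

Lemma nrm_belt_lb X (c : {ffun 'I_n -> 'I_X}) : (0 < X)%N ->
  (X ^ n <= `|nrm k f (belt c)|)%N.
Proof.
move=> X0; have := nrm_belt c; have /andP[lb _] := center_gt X0.
have : (2 * X ^ n <= center X ^ n)%N.
  apply: (@leq_trans ((2 * X) ^ n)%N); last by rewrite leq_exp2r.
  by rewrite expnMn leq_mul2r -{1}(expn1 2) leq_exp2l // orbT.
by move: (center X ^ n)%N (X ^ n)%N (nrm _ _ _) => a b c'; lia.
Qed.

Lemma nrm_belt_ub X (c : {ffun 'I_n -> 'I_X}) : (0 < X)%N ->
  (`|nrm k f (belt c)| <= (belt_bound * X) ^ n)%N.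
Proof.
move=> X0; have := nrm_belt c; have /andP[_ ub] := center_gt X0.
have : (2 * center X ^ n <= (belt_bound * X) ^ n)%N.
  apply: (@leq_trans ((2 * center X) ^ n)%N); last first.
    by rewrite leq_exp2r // /belt_bound -mulnA leq_mul2l.
  by rewrite expnMn leq_mul2r -{1}(expn1 2) leq_exp2l // orbT.
by move: (center X ^ n)%N (_ ^ n)%N (nrm _ _ _) => a b c'; lia.
Qed.

Lemma nrm_belt_coprime p X (c : {ffun 'I_n -> 'I_X}) : prime p -> (p %| Q)%N ->
  ~~ (p %| `|nrm k f (belt c)|)%N.
Proof.
move=> p_prime pQ; apply: coprime_nrm => //.
have Q0 : (Q%:Z)%:~R = 0 :> 'F_p by apply/eqP; rewrite Fp_intr_eq0.
rewrite /belt rmorphD /= map_polyZ /= Q0 scale0r addr0 map_polyC /=.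
rewrite /center -mulnA PoszD PoszM rmorphD rmorphM /= Q0 mul0r addr0.
exact: coprime1p.
Qed.

Section Unramified.
Variable p : nat.
Hypotheses (p_prime : prime p) (pQ : ~~ (p %| Q)%N).
Let fp : {poly 'F_p} := map_poly intr f.
Hypothesis unram : coprimep fp fp^`().

Definition count_power X j : nat :=
  #|[pred c : {ffun 'I_n -> 'I_X} | (p ^ j %| `|nrm k f (belt c)|)%N]|.

Definition power_const : nat := (nrm_bound k f).+1 * belt_bound.+1 ^ n.

(** There are n^j classes. Two points of one class differ by v with p^j dividing the nonzero N(v),
    as p does not divide Q; so |N(v)| >= p^j separates them. The successor in [power_const] keeps
    the constant positive. *)
Lemma count_power_ub X j : (0 < X)%N ->
  (count_power X j * p ^ j <= n ^ j * (power_const * X ^ n))%N.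
Proof.
move=> X0; have [cls [cls_sub cls_dvd cls_cover]] := power_classes f_monic sf p_prime unram j.
pose A s : pred {ffun 'I_n -> 'I_X} := [pred c | `[< cls s (belt c) >]].
have cA : (count_power X j <= \sum_(s : j.-tuple 'I_n) #|A s|)%N.
  rewrite /count_power -sum1_card.
  rewrite [X in (_ <= X)%N](eq_bigr (fun s => \sum_(c in A s) 1)%N) => [|s _]; last first.
    by rewrite sum1_card.
  rewrite (exchange_big_dep predT) //= big_mkcond /=; apply: leq_sum => c _.
  case: ifP => // /cls_cover [|s cs]; first exact: nrm_belt_neq0.
  by rewrite (bigD1 s) ?leq_addr //; apply/asboolP.
apply: leq_trans (leq_mul cA (leqnn _)) _; rewrite big_distrl /=.
have -> : (n ^ j * (power_const * X ^ n)
    = \sum_(s : j.-tuple 'I_n) (power_const * X ^ n))%N.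
  by rewrite sum_nat_const card_tuple card_ord.
apply: leq_sum => s _; rewrite /power_const -mulnA -expnMn.
apply: separated_card => //.
- by rewrite expn_gt0 prime_gt0.
- move=> c /asboolP /cls_dvd dv; apply: leq_trans (nrm_belt_ub c X0).
  by apply: dvdn_leq; rewrite ?absz_gt0 ?nrm_belt_neq0.
move=> a b h /asboolP Aa /asboolP Ab ab close.
pose v := brow a - brow b.
have v0 : v != 0.
  apply: contraNneq ab => /eqP; rewrite subr_eq0 => /eqP/rowP e.
  by apply/eqP/ffunP => i; have := e i; rewrite !mxE => -[/val_inj].
have n0 : nrm k f (rVpoly v) != 0.
  apply: nrm_neq0 => //; last exact: size_poly.
  by apply: contraNneq v0 => e; rewrite -[v]rVpolyK e linear0.
have : (p ^ j %| `|nrm k f (rVpoly v)|)%N.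
  have := cls_dvd _ _ (cls_sub _ _ _ Aa Ab).
  rewrite /belt opprD addrACA subrr add0r -scalerBr -linearB nrmZ abszM abszX absz_nat.
  by rewrite Gauss_dvdr // coprimeXl // coprimeXr // prime_coprime.
move=> /dvdn_leq; rewrite absz_gt0 n0 => /(_ isT) /leq_trans; apply.
apply: leq_trans (_ : nrm_bound k f * h ^ n <= _)%N; last by rewrite leq_mul2r leqnSn orbT.
apply: nrm_le => i; rewrite /v !mxE; have := close i.
by move: (nat_of_ord (a i)) (nat_of_ord (b i)) => x y; clear; lia.
Qed.

(** Double counting: a belt element vanishes at [rho] exactly when its box point takes the value
    -center/Q there. *)
Lemma card_common_roots_sum X :
  (\sum_(c : {ffun 'I_n -> 'I_X}) #|common_roots f (p := p) (belt c)| =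
   \sum_(rho | root fp rho) fiber_count X rho (- (center X)%:R / Q%:R))%N.
Proof.
rewrite (eq_bigr (fun c => \sum_(rho in common_roots f (p := p) (belt c)) 1)%N) => [|c _];
  last by rewrite sum1_card.
rewrite (exchange_big_dep (root fp)) /=; last by move=> c rho _; rewrite inE => /andP[].
apply: eq_bigr => rho frho; rewrite /fiber_count -sum1_card.
apply: eq_bigl => c; rewrite !inE frho /=.
have Q0 : Q%:R != 0 :> 'F_p by rewrite -(dvdn_pcharf (pchar_Fp p_prime)).
rewrite /root /belt rmorphD /= map_polyZ map_polyC /= hornerD hornerC hornerZ -!pmulrn.
rewrite addrC addr_eq0 -(inj_eq (mulfI Q0) _ (- _ / _)) mulrC [RHS]eq_sym.
by rewrite [X in _ = (X == _)]mulrC divfK // eq_sym mulrC.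
Qed.

End Unramified.
End Boxes.

(** * Sums over primes *)

Lemma dvdn_prod_primes (s : seq nat) N : uniq s -> all prime s ->
  (forall p, p \in s -> p %| N)%N -> (\prod_(p <- s) p %| N)%N.
Proof.
elim: s => [|p s IH] /= => [_ _ _|/andP[ps us] /andP[p_prime s_prime] sN].
  by rewrite big_nil dvd1n.
rewrite big_cons Gauss_dvd; last first.
  rewrite big_seq; apply/(big_rec (fun x => coprime p x)); first exact: coprimen1.
  move=> q x qs cx; rewrite coprimeMr cx andbT prime_coprime //.
  have q_prime : prime q by exact: (allP s_prime).
  by rewrite dvdn_prime2 //; apply: contraNneq ps => ->.
rewrite sN ?mem_head //= IH // => q qs.
by apply: sN; rewrite inE qs orbT.
Qed.

Lemma dvd_fact_leq p m : prime p -> (p %| m`!)%N -> (p <= m)%N.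
Proof.
move=> p_prime; elim: m => [|m IH]; first by rewrite fact0 Euclid_dvd1.
rewrite factS Euclid_dvdM // => /orP[/dvdn_leq -> //|/IH]; exact: leqW.
Qed.

(** The row sum 2^(2m+1) contains this middle coefficient twice. *)
Lemma bin_middle_le m : ('C(m.*2.+1, m) <= 4 ^ m)%N.
Proof.
have := expnDn 1 1 m.*2.+1; rewrite addn1.
have m1 : (m < m.*2.+2)%N by rewrite -addnn; lia.
have m2 : (m.+1 < m.*2.+2)%N by rewrite -addnn; lia.
rewrite (bigD1 (Ordinal m1)) //= (bigD1 (Ordinal m2)) /=; last first.
  by rewrite -val_eqE /= neq_ltn leqnn orbT.
rewrite !exp1n !muln1 -[in 'C(_, m.+1)]bin_sub; last by rewrite -addnn; lia.
have -> : (m.*2.+1 - m.+1 = m)%N by rewrite -addnn; lia.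
have -> : (2 ^ m.*2.+1 = 2 * 4 ^ m)%N by rewrite expnS -mul2n expnM.
set S := (\sum_(_ < _ | _) _)%N.
by move: 'C(_, _) S (4 ^ m)%N => a b c; lia.
Qed.

(** The argument of Erdos: for an odd prime 2m+1, the primes above m+1 and up to 2m+1 all divide the
    middle binomial coefficient, and induction handles those up to m+1. *)
Lemma primorial_le x : (\prod_(p < x.+1 | prime p) p <= 4 ^ x)%N.
Proof.
have [y] := ubnP x; elim: y x => // y IH [|x] /ltnSE xy.
  by rewrite big_mkcond big_ord_recr big_ord0.
have [x_prime|x_nprime] := boolP (prime x.+1); last first.
  rewrite big_mkcond big_ord_recr /= -big_mkcond (negPf x_nprime) muln1.
  by apply: leq_trans (IH x xy) _; rewrite leq_exp2l.
have [->|x_odd] := even_prime x_prime.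
  by rewrite big_mkcond !big_ord_recr big_ord0.
pose m := x./2.
have xm : x = m.*2 by rewrite even_halfK //; move: x_odd; rewrite /= negbK.
have m_gt0 : (0 < m)%N.
  by rewrite lt0n; apply: contraTneq x_prime => m0; rewrite xm m0.
have IHm : (\prod_(p < m.+2 | prime p) p <= 4 ^ m.+1)%N.
  by apply: IH; move: xm xy; rewrite -addnn; lia.
pose s := [seq p <- iota m.+2 m | prime p].
have -> : (\prod_(p < x.+2 | prime p) p =
    (\prod_(p < m.+2 | prime p) p) * \prod_(p <- s) p)%N.
  rewrite -!(big_mkord prime id) (@big_cat_nat _ _ _ m.+2) //=; last by rewrite xm -addnn; lia.
  congr (_ * _)%N; rewrite big_filter /index_iota xm.
  by congr (bigop _ _ _); congr iota; rewrite -addnn; lia.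
have sC : (\prod_(p <- s) p %| 'C(m.*2.+1, m))%N.
  apply: dvdn_prod_primes; rewrite ?filter_uniq ?iota_uniq ?filter_all //.
  move=> p; rewrite mem_filter mem_iota => /andP[p_prime /andP[p1 p2]].
  have mm : (m <= m.*2.+1)%N by rewrite -addnn; lia.
  have : (p %| 'C(m.*2.+1, m) * (m`! * (m.*2.+1 - m)`!))%N.
    rewrite bin_fact //; apply: dvdn_fact; rewrite prime_gt0 //=.
    by move: p2; rewrite -addnn; lia.
  rewrite !Euclid_dvdM // => /orP[//|/orP[]] /(dvd_fact_leq p_prime).
    by move: p1; lia.
  by move: p1; rewrite -addnn; lia.
have sle := leq_trans (dvdn_leq _ sC) (bin_middle_le m).
apply: leq_trans (leq_mul IHm (sle _)) _; first by rewrite bin_gt0 -addnn; lia.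
by rewrite -expnD leq_exp2l // xm -addnn; lia.
Qed.

Section PrimeSums.
Variable R : realType.

Lemma chebyshev_theta x :
  \sum_(p < x.+1 | prime p) ln (p%:R : R) <= ln 4%:R * x%:R.
Proof.
have <- : ln ((\prod_(p < x.+1 | prime p) p)%N%:R : R) =
    \sum_(p < x.+1 | prime p) ln (p%:R : R).
  rewrite natr_prod.
  suff [] : 0 < \prod_(p < x.+1 | prime p) (p%:R : R) /\
      ln (\prod_(p < x.+1 | prime p) (p%:R : R)) =
      \sum_(p < x.+1 | prime p) ln (p%:R : R) by [].
  apply: (big_rec2 (fun a b => 0 < a /\ ln a = b)) => [|p a b p_prime [b0 <-]].
    by rewrite ltr01 ln1.
  have p0 : 0 < (p%:R : R) by rewrite ltr0n prime_gt0.
  by rewrite mulr_gt0 // lnM ?posrE.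
rewrite mulr_natr -lnXn ?ltr0n // -natrX ler_ln ?posrE ?ltr0n ?expn_gt0 //.
  by rewrite ler_nat primorial_le.
by rewrite prodn_cond_gt0 // => p /prime_gt0.
Qed.

Lemma ln_prime_ge0 p : prime p -> 0 <= ln (p%:R : R).
Proof. by move=> p_prime; rewrite ln_ge0 // ler1n prime_gt0. Qed.

(** A substitute for partial summation: primes with the same [up_log b p] = i are at most b^i, so
    Chebyshev's bound applies to each band. *)
Lemma band_sum b (w : nat -> R) x : (1 < b)%N -> (forall i, 0 <= w i) ->
  \sum_(p < (b ^ x).+1 | prime p) ln (p%:R : R) * w (up_log b p) <=
  \sum_(i < x.+1) ln 4%:R * b%:R ^+ i * w i.
Proof.
move=> b1 w0.
have upx (p : 'I_(b ^ x).+1) : (up_log b p < x.+1)%N.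
  by rewrite ltnS up_log_min // -ltnS.
rewrite (partition_big (fun p : 'I_(b ^ x).+1 => Ordinal (upx p)) predT) //=.
apply: ler_sum => i _.
apply: (@le_trans _ _ ((\sum_(p < (b ^ i).+1 | prime p) ln (p%:R : R)) * w i)); last first.
  by rewrite ler_wpM2r // -natrX chebyshev_theta.
rewrite mulr_suml.
have bi : ((b ^ i).+1 <= (b ^ x).+1)%N.
  by rewrite ltnS leq_pexp2l ?(ltnW b1) // -ltnS.
rewrite (big_ord_widen_cond _ prime (fun p => ln (p%:R : R) * w i) bi).
rewrite [X in X <= _]big_mkcond [X in _ <= X]big_mkcond /=.
apply: ler_sum => p _; case: (boolP (prime p)) => //= p_prime.
case: eqP => [<- /=|_]; first by rewrite ltnS up_logP.
by case: ifP => // _; rewrite mulr_ge0 ?ln_prime_ge0.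
Qed.

End PrimeSums.

Section PrimeSumBounds.
Variable R : realType.

Lemma ln_sum_logn N M : (0 < N <= M)%N ->
  ln (N%:R : R) = \sum_(p < M.+1 | prime p) (logn p N)%:R * ln (p%:R : R).
Proof.
move=> /andP[N0 NM].
have {1}-> : N = (\prod_(p < M.+1 | prime p) p ^ logn p N)%N.
  rewrite -[LHS](partnT N0) (widen_partn _ NM) big_mkord [RHS]big_mkcond.
  apply: eq_bigr => p _; case: (boolP (prime p)) => //= p_nprime.
  by rewrite lognE (negPf p_nprime).
rewrite natr_prod.
suff [] : 0 < \prod_(p < M.+1 | prime p) ((p ^ logn p N)%N%:R : R) /\
      ln (\prod_(p < M.+1 | prime p) ((p ^ logn p N)%N%:R : R)) =
      \sum_(p < M.+1 | prime p) (logn p N)%:R * ln (p%:R : R) by [].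
apply: (big_rec2 (fun a b => 0 < a /\ ln a = b)) => [|p a b p_prime [b0 <-]].
  by rewrite ltr01 ln1.
have p0 : 0 < ((p ^ logn p N)%N%:R : R) by rewrite ltr0n expn_gt0 prime_gt0.
rewrite mulr_gt0 // lnM ?posrE // natrX lnXn ?ltr0n ?prime_gt0 //.
by rewrite mulr_natl.
Qed.

Lemma geometric_half_le m : \sum_(i < m) (2^-1 : R) ^+ i <= 2.
Proof.
suff -> : \sum_(i < m) (2^-1 : R) ^+ i = 2 - 2 * 2^-1 ^+ m.
  by rewrite gerBl mulr_ge0 // exprn_ge0 // invr_ge0.
elim: m => [|m IH]; first by rewrite big_ord0 expr0 mulr1 subrr.
by rewrite big_ord_recr /= IH exprS; field.
Qed.

Lemma up_log_band b p : (1 < b)%N -> prime p -> (b ^ up_log b p <= b * p)%N.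
Proof.
move=> b1 p_prime; have p1 := prime_gt1 p_prime.
have : (0 < up_log b p)%N by rewrite up_log_gt0 b1.
have := up_log_gtn b1 p1; case: (up_log b p) => // i /= lt _.
by rewrite expnS leq_mul2l ltnW // orbT.
Qed.

(** On band i, 1/p^2 <= 4 * 4^-i against a Chebyshev mass ln 4 * 2^i, a geometric series of ratio
    1/2. *)
Lemma sum_ln_inv_square_le m :
  \sum_(p < m.+1 | prime p) ln (p%:R : R) / p%:R ^+ 2 <= 8 * ln 4%:R.
Proof.
have [x mx] : exists x, (m.+1 <= (2 ^ x).+1)%N.
  by exists m; rewrite ltnS ltnW // ltn_expl.
rewrite (big_ord_widen_cond _ prime (fun p => ln (p%:R : R) / p%:R ^+ 2) mx).
apply: le_trans (_ : \sum_(p < (2 ^ x).+1 | prime p)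
    ln (p%:R : R) * (4 * (4^-1) ^+ up_log 2 p) <= _).
  rewrite big_mkcond [X in _ <= X]big_mkcond; apply: ler_sum => p _.
  case: (boolP (prime p)) => //= p_prime.
  have l0 := ln_prime_ge0 R p_prime.
  have : ln (p%:R : R) / p%:R ^+ 2 <= ln (p%:R : R) * (4 * (4^-1) ^+ up_log 2 p).
    apply: ler_wpM2l => //.
    have p0 : 0 < (p%:R : R) by rewrite ltr0n prime_gt0.
    rewrite exprVn ler_pdivlMr ?exprn_gt0 // mulrC ler_pdivrMr ?exprn_gt0 //.
    have : ((2 ^ up_log 2 p)%N%:R : R) ^+ 2 <= ((2 * p)%N%:R) ^+ 2.
      by rewrite ler_pXn2r ?nnegrE // ler_nat up_log_band.
    have four : 2 * 2 = 4 :> R by ring.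
    by rewrite natrX natrM exprMn !(expr2 2) expr2 -exprMn four.
  by case: ifP => // _ _; rewrite !mulr_ge0 // exprn_ge0 // invr_ge0.
have w0 i : 0 <= 4 * 4^-1 ^+ i :> R by rewrite mulr_ge0 // exprn_ge0 // invr_ge0.
apply: le_trans (band_sum (b := 2) x isT w0) _.
have -> : \sum_(i < x.+1) ln (4%:R : R) * 2%:R ^+ i * (4 * (4^-1) ^+ i)
    = 4 * ln 4%:R * \sum_(i < x.+1) 2^-1 ^+ i.
  rewrite mulr_sumr; apply: eq_bigr => i _.
  have -> : (4^-1 : R) = 2^-1 * 2^-1 by field.
  have : (2%:R ^+ i) * (2^-1) ^+ i = 1 :> R by rewrite -exprMn mulfV ?expr1n ?pnatr_eq0.
  by rewrite exprMn; set a := 2%:R ^+ i; set c := 2^-1 ^+ i => ac; rewrite -[RHS]mul1r -ac; ring.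
have l4 : 0 <= ln (4%:R : R) by rewrite ln_ge0 // ler1n.
have := geometric_half_le x.+1; set s := \sum_(_ < _) _ => s2.
have -> : 8 * ln (4%:R : R) = 4 * ln 4%:R * 2 by ring.
by rewrite ler_wpM2l // mulr_ge0.
Qed.

(** With bands of ratio 2^n the Chebyshev mass cancels 1/p and leaves 2^i on band i. The sum is O(X)
    for X = 2^x, so the relative errors p^(1/n)/X add up to O(1). *)
Lemma sum_ln_root_le n x : (0 < n)%N ->
  \sum_(p < ((2 ^ x) ^ n).+1 | prime p)
    ln (p%:R : R) * (2%:R ^+ up_log (2 ^ n) p / p%:R) <= 2 ^+ n.+1 * ln 4%:R * 2 ^+ x.
Proof.
move=> n0; have b1 : (1 < 2 ^ n)%N by rewrite -{1}(expn0 2) ltn_exp2l.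
rewrite -expnM mulnC expnM.
apply: le_trans (_ : \sum_(p < ((2 ^ n) ^ x).+1 | prime p)
    ln (p%:R : R) * (2 ^+ up_log (2 ^ n) p * (2 ^+ n / (2 ^+ n) ^+ up_log (2 ^ n) p)) <= _).
  rewrite big_mkcond [X in _ <= X]big_mkcond; apply: ler_sum => p _.
  have [p_prime|//] := ifP; apply: ler_wpM2l; first exact: ln_prime_ge0.
  apply: ler_wpM2l; first exact: exprn_ge0.
  have p0 : 0 < (p%:R : R) by rewrite ltr0n prime_gt0.
  rewrite ler_pdivlMr ?exprn_gt0 // mulrC ler_pdivrMr //.
  by rewrite -!natrX -natrM ler_nat up_log_band.
have w0 i : 0 <= 2 ^+ i * (2 ^+ n / (2 ^+ n) ^+ i) :> R.
  by apply: mulr_ge0; [|apply: divr_ge0]; do ?apply: exprn_ge0.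
apply: le_trans (band_sum x b1 w0) _.
have l4 : 0 <= ln (4%:R : R) by rewrite ln_ge0 // ler1n.
have -> : \sum_(i < x.+1) ln (4%:R : R) * (2 ^ n)%:R ^+ i * (2 ^+ i * (2 ^+ n / (2 ^+ n) ^+ i))
    = 2 ^+ n * ln 4%:R * \sum_(i < x.+1) 2 ^+ i.
  rewrite mulr_sumr; apply: eq_bigr => i _; rewrite natrX.
  have : (2 ^+ n) ^+ i != 0 :> R by rewrite !expf_neq0 ?pnatr_eq0.
  by move: ((2 ^+ n) ^+ i) => a a0; field.
have -> : 2 ^+ n.+1 * ln 4%:R * 2 ^+ x = 2 ^+ n * ln 4%:R * (2 * 2 ^+ x) :> R.
  by rewrite exprS; ring.
apply: ler_wpM2l; first by rewrite mulr_ge0 // exprn_ge0.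
suff -> : \sum_(i < x.+1) 2 ^+ i = 2 * 2 ^+ x - 1 :> R by rewrite gerBl.
elim: x => [|x IH]; first by rewrite big_ord_recl big_ord0 !expr0; ring.
by rewrite big_ord_recr /= IH !exprS; ring.
Qed.

Lemma geometric_tail_le m (x : R) : 0 <= x -> 2 * x <= 1 ->
  \sum_(2 <= j < m) x ^+ j <= 2 * x ^+ 2.
Proof.
move=> x0 x1; case: (leqP m 2) => [m2|m2].
  by rewrite big_geq // mulr_ge0 // exprn_ge0.
suff : \sum_(2 <= j < m) x ^+ j <= 2 * x ^+ 2 - 2 * x ^+ m.
  by move=> /le_trans; apply; rewrite gerBl mulr_ge0 // exprn_ge0.
elim: m m2 => // m IH; rewrite ltnS leq_eqVlt => /orP[/eqP <-|m2].
  rewrite big_nat1 (exprS x 2); have : 0 <= x ^+ 2 by rewrite exprn_ge0.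
  by set y := x ^+ 2 => y0; nra.
rewrite big_nat_recr ?(ltnW m2) //=; apply: le_trans (lerD (IH m2) (lexx _)) _.
rewrite (exprS x m); have : 0 <= x ^+ m by rewrite exprn_ge0.
set y := x ^+ m => y0; have := ler_wpM2l y0 x1.
by move: (x ^+ 2) => z; nra.
Qed.

Lemma bernoulli_le n (w : R) : 0 <= w -> w <= 1 -> 1 - n%:R * w <= (1 - w) ^+ n.
Proof.
move=> w0 w1; elim: n => [|n IH]; first by rewrite mul0r subr0 expr0.
rewrite exprS -natr1; have w1' : 0 <= 1 - w by rewrite subr_ge0.
apply: le_trans (ler_wpM2l w1' IH).
have : 0 <= n%:R * w * w by rewrite !mulr_ge0.
rewrite mulrDl mul1r; move: (n%:R * w) => a h.
have -> : (1 - w) * (1 - a) = 1 - (a + w) + a * w by ring.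
by rewrite lerDl.
Qed.

Lemma expr1D_le n (w : R) : 0 <= w -> (1 + w) ^+ n.+1 <= 1 + n.+1%:R * w * (1 + w) ^+ n.
Proof.
move=> w0; elim: n => [|n IH]; first by rewrite expr1 expr0 mulr1 mul1r.
have w1' : 0 <= 1 + w by rewrite addr_ge0.
rewrite exprS; apply: le_trans (ler_wpM2l w1' IH) _.
have e1 : 1 <= (1 + w) ^+ n.+1 by rewrite exprn_ege1 // lerDl.
rewrite -(natr1 n.+1) [in leRHS]exprS; rewrite exprS in e1.
have := ler_wpM2l w0 e1.
move: (n.+1%:R) ((1 + w) ^+ n) => a b; rewrite mulr1 => h.
have -> : (1 + w) * (1 + a * w * b) = 1 + w + a * w * ((1 + w) * b) by ring.
have -> : 1 + (a + 1) * w * ((1 + w) * b) = 1 + w * ((1 + w) * b) + a * w * ((1 + w) * b) by ring.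
by rewrite lerD2r lerD2l.
Qed.

End PrimeSumBounds.

(** * Primes modulo which f has a root *)

Section SplitPrimes.
Variables (R : realType) (k : nat) (f : {poly int}).
Hypotheses (f_monic : f \is monic) (sf : size f = k.+2) (f_min : coprime_below f).
Variable Q : nat.
Hypothesis Q_gt0 : (0 < Q)%N.
(** The bound 2n <= p keeps the ratio n/p of the series over powers of p at most 1/2; coprimality
    with the derivative makes f squarefree mod p. *)
Hypothesis Q_spec : forall p, prime p -> ~~ (p %| Q)%N ->
  (2 * k.+1 <= p)%N /\
  coprimep (map_poly intr f : {poly 'F_p}) (map_poly intr f)^`().

Let n := k.+1.
Let b := belt_bound k f Q.

Definition has_root p := [exists rho : 'F_p, root (map_poly intr f) rho].

Definition root_count p X : nat :=
  \sum_(rho : 'F_p | root (map_poly intr f) rho)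
    fiber_count k X rho (- (center k f Q X)%:R / Q%:R : 'F_p).

Definition nrm_valuation p X : nat :=
  \sum_(c : {ffun 'I_n -> 'I_X}) logn p `|nrm k f (belt f Q c)|.

Lemma root_count_le_valuation p X : prime p -> ~~ (p %| Q)%N ->
  (root_count p X <= nrm_valuation p X)%N.
Proof.
move=> p_prime pQ; have [_ unram] := Q_spec p_prime pQ.
rewrite /root_count -(card_common_roots_sum k f p_prime pQ).
apply: leq_sum => c _; apply: card_common_roots => //.
exact: nrm_belt_neq0.
Qed.

(** Summing v <= #roots + 2 (v - 1) over the belt, where v - 1 counts the j >= 2 with p^j dividing
    the norm; no norm exceeds (bX)^n, so the range of j is long enough. *)
Lemma valuation_le p X : prime p -> ~~ (p %| Q)%N -> (0 < X)%N ->
  (nrm_valuation p X <= root_count p X +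
    2 * \sum_(2 <= j < ((b * X) ^ n).+1) count_power k f Q p X j)%N.
Proof.
move=> p_prime pQ X0; have [_ unram] := Q_spec p_prime pQ.
rewrite /root_count -(card_common_roots_sum k f p_prime pQ).
have -> : (\sum_(2 <= j < ((b * X) ^ n).+1) count_power k f Q p X j =
    \sum_(c : {ffun 'I_n -> 'I_X}) \sum_(2 <= j < ((b * X) ^ n).+1)
      (p ^ j %| `|nrm k f (belt f Q c)|))%N.
  rewrite exchange_big /=; apply: eq_bigr => j _.
  rewrite /count_power -sum1_card big_mkcond /=; apply: eq_bigr => c _.
  by rewrite inE; case: (_ %| _)%N.
rewrite big_distrr -big_split /=; apply: leq_sum => c _.
have c0 := nrm_belt_neq0 f_monic sf Q_gt0 c.
apply: leq_trans (logn_nrm_le f_monic sf p_prime unram c0) _.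
rewrite leq_add2l leq_mul2l /=; set N := `|_|%N.
have N0 : (0 < N)%N by rewrite absz_gt0.
have vN : (logn p N < ((b * X) ^ n).+1)%N.
  rewrite ltnS; apply: leq_trans (nrm_belt_ub f_monic sf Q_gt0 c X0).
  by apply/ltnW/ltn_logl.
set v := logn p N.
rewrite (eq_bigr (fun j => nat_of_bool (j <= v)%N)) => [|j _]; last by rewrite pfactor_dvdn.
have [v1|v2] := leqP v 1; first by have -> : (v - 1 = 0)%N by move: v1; lia.
rewrite (@big_cat_nat _ _ _ v.+1) //=; last exact: ltnW.
apply: leq_trans (leq_addr _ _).
rewrite (eq_big_nat _ _ (F2 := fun _ => 1%N)) => [|j /andP[_]]; last by rewrite ltnS => ->.
by rewrite sum_nat_const_nat muln1; move: v2; lia.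
Qed.

Lemma valuation_bad p X : prime p -> (p %| Q)%N -> nrm_valuation p X = 0%N.
Proof.
move=> p_prime pQ; apply: big1 => c _.
by rewrite lognE (negPf (nrm_belt_coprime f_monic sf c p_prime pQ)) !andbF.
Qed.

Lemma card_roots_le p : prime p ->
  (#|[pred rho : 'F_p | root (map_poly intr f) rho]| <= n)%N.
Proof.
move=> p_prime; set fp := map_poly intr f.
have fp0 : fp != 0 by rewrite monic_neq0 // monic_map.
have sfp : size fp = n.+1 by rewrite size_map_poly_id0 ?sf // (monicP f_monic) oner_eq0.
have := max_poly_roots fp0 (_ : all (root fp) (enum [pred rho | root fp rho])).
rewrite sfp ltnS cardE; apply; last exact: enum_uniq.
by apply/allP => r; rewrite mem_enum.
Qed.

(* 2 ^ up_log (2 ^ n) p is p^(1/n) rounded up to a power of two. *)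
Definition halfwidth p : nat := n * entry_bound k f * 2 ^ up_log (2 ^ n) p.

Lemma up_log_root_lt p : (p < (2 ^ up_log (2 ^ n) p).+1 ^ n)%N.
Proof.
apply: leq_ltn_trans (up_logP p (_ : 1 < 2 ^ n)%N) _; first by rewrite -{1}(expn0 2) ltn_exp2l.
by rewrite -expnM mulnC expnM ltn_exp2r.
Qed.

Lemma root_count_ub p X : prime p ->
  (p * root_count p X <= #|[pred rho : 'F_p | root (map_poly intr f) rho]|
     * (X + 2 * halfwidth p) ^ n)%N.
Proof.
move=> p_prime; rewrite /root_count big_distrr -sum_nat_const /=.
apply: leq_sum => rho rt.
exact: (fiber_count_ub f_monic sf f_min X _ p_prime (up_log_root_lt p) rt).
Qed.

Lemma root_count_lb p X : prime p ->
  (#|[pred rho : 'F_p | root (map_poly intr f) rho]| * X ^ n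
   <= p * root_count p (X + 2 * halfwidth p))%N.
Proof.
move=> p_prime; rewrite /root_count big_distrr -sum_nat_const /=.
apply: leq_sum => rho rt.
exact: (fiber_count_lb f_monic sf f_min X _ p_prime (up_log_root_lt p) rt).
Qed.

(* For p | Q the residue in root_count is a division by 0 in 'F_p; no norm in the
   belt is divisible by such a p. *)
Definition root_mean p X : R :=
  if (p %| Q)%N then 0 else (root_count p X)%:R / X%:R ^+ n.

Definition valuation_mean p X : R := (nrm_valuation p X)%:R / X%:R ^+ n.

Lemma root_mean_le_valuation_mean p X : prime p ->
  root_mean p X <= valuation_mean p X.
Proof.
move=> p_prime; rewrite /root_mean; case: ifPn => [_|pQ].
  by rewrite divr_ge0 // exprn_ge0.
by rewrite ler_wpM2r ?invr_ge0 ?exprn_ge0 // ler_nat root_count_le_valuation.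
Qed.

(** One factor 2 comes from the excess valuation, the other from the geometric tail in n/p. *)
Definition square_const : R := 4 * n%:R ^+ 2 * (power_const k f Q)%:R.

Lemma valuation_mean_le p X : prime p -> (0 < X)%N ->
  valuation_mean p X <= root_mean p X + square_const / p%:R ^+ 2.
Proof.
move=> p_prime X0; have p0 : 0 < (p%:R : R) by rewrite ltr0n prime_gt0.
have sq0 : 0 <= square_const / p%:R ^+ 2.
  by rewrite divr_ge0 ?exprn_ge0 // !mulr_ge0 // exprn_ge0.
rewrite /root_mean /valuation_mean; case: ifPn => pQ.
  by rewrite valuation_bad // mul0r add0r.
have [np unram] := Q_spec p_prime pQ.
have Xn0 : 0 < (X%:R : R) ^+ n by rewrite exprn_gt0 // ltr0n.
rewrite ler_pdivrMr // mulrDl divfK ?gt_eqF //.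
apply: le_trans (_ : (root_count p X + 2 * \sum_(2 <= j < ((b * X) ^ n).+1)
    count_power k f Q p X j)%N%:R <= _).
  by rewrite ler_nat valuation_le.
rewrite natrD lerD2l natrM natr_sum.
pose x : R := n%:R / p%:R.
have xp : 2 * x <= 1.
  by rewrite /x mulrA ler_pdivrMr // mul1r -natrM ler_nat.
have x0 : 0 <= x by rewrite divr_ge0 // ltW.
have cj j : (count_power k f Q p X j)%:R <= x ^+ j * ((power_const k f Q)%:R * X%:R ^+ n).
  rewrite /x expr_div_n mulrAC ler_pdivlMr ?exprn_gt0 //.
  by rewrite -!natrX -!natrM ler_nat; exact: count_power_ub.
apply: le_trans (ler_wpM2l _ (ler_sum _ (fun j _ => cj j))) _ => //.
rewrite -mulr_suml; have := geometric_tail_le ((b * X) ^ n).+1 x0 xp.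
set s := \sum_(_ <= _ < _) _ => sx.
have -> : square_const / p%:R ^+ 2 * X%:R ^+ n =
    2 * (2 * x ^+ 2 * ((power_const k f Q)%:R * X%:R ^+ n)).
  by rewrite /square_const /x expr_div_n; ring.
by rewrite ler_wpM2l // ler_wpM2r // mulr_ge0 // exprn_ge0.
Qed.

Lemma root_mean_nonsplit p X : ~~ has_root p -> root_mean p X = 0.
Proof.
move=> nr; rewrite /root_mean; case: ifP => // _; rewrite /root_count big_pred0 ?mul0r // => rho.
by apply/negP => rt; move/existsP: nr; apply; exists rho.
Qed.

Lemma root_mean_ub p X (w : R) : prime p -> (0 < X)%N ->
  (2 * halfwidth p)%:R <= w * X%:R ->
  root_mean p X <=
    #|[pred rho : 'F_p | root (map_poly intr f) rho]|%:R / p%:R * (1 + w) ^+ n.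
Proof.
move=> p_prime X0 wX; have p0 : 0 < (p%:R : R) by rewrite ltr0n prime_gt0.
have X0' : 0 < (X%:R : R) by rewrite ltr0n.
have w0 : 0 <= w by rewrite -(pmulr_lge0 _ X0'); apply: le_trans wX.
rewrite /root_mean; case: ifP => _.
  by rewrite mulr_ge0 ?exprn_ge0 ?divr_ge0 // addr_ge0.
set r := #|_|; rewrite ler_pdivrMr ?exprn_gt0 //.
have -> : r%:R / p%:R * (1 + w) ^+ n * X%:R ^+ n =
  r%:R * ((1 + w) ^+ n * X%:R ^+ n) / p%:R by ring.
rewrite ler_pdivlMr // mulrC -natrM.
apply: le_trans (_ : (_ * (X + 2 * halfwidth p) ^ n)%N%:R <= _).
  by rewrite ler_nat; exact: root_count_ub.
rewrite natrM natrX -exprMn ler_wpM2l // lerXn2r ?nnegrE //.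
  by rewrite mulr_ge0 ?addr_ge0 // ltW.
by rewrite natrD mulrDl mul1r lerD2l.
Qed.

(** w is the widening relative to the side. For w <= 1 the inner box of side X - wX and Bernoulli's
    inequality apply; for w > 1 the left side is not positive. *)
Lemma root_mean_lb p X (w : R) : prime p -> ~~ (p %| Q)%N -> (0 < X)%N ->
  (2 * halfwidth p)%:R = w * X%:R ->
  #|[pred rho : 'F_p | root (map_poly intr f) rho]|%:R / p%:R * (1 - n%:R * w)
    <= root_mean p X.
Proof.
move=> p_prime pQ X0 wX; have p0 : 0 < (p%:R : R) by rewrite ltr0n prime_gt0.
have X0' : 0 < (X%:R : R) by rewrite ltr0n.
have w0 : 0 <= w by rewrite -(pmulr_lge0 _ X0') -wX.
have rm0 : 0 <= root_mean p X.
  by rewrite /root_mean (negPf pQ) divr_ge0 // exprn_ge0.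
have [w1|w1] := leP w 1; last first.
  apply: le_trans rm0; rewrite mulr_ge0_le0 // ?divr_ge0 ?(ltW p0) // subr_le0.
  by rewrite mulr_ege1 ?(ltW w1) // ler1n.
have DX : (2 * halfwidth p <= X)%N.
  by rewrite -(ler_nat R) wX ger_pMl.
have r0 : 0 <= (#|[pred rho : 'F_p | root (map_poly intr f) rho]|%:R / p%:R : R).
  by rewrite divr_ge0 // ltW.
apply: le_trans (ler_wpM2l r0 (bernoulli_le n w0 w1)) _.
set r := #|_|; rewrite /root_mean (negPf pQ) ler_pdivlMr ?exprn_gt0 //.
have -> : r%:R / p%:R * (1 - w) ^+ n * X%:R ^+ n =
  r%:R * ((1 - w) ^+ n * X%:R ^+ n) / p%:R by ring.
rewrite ler_pdivrMr // [X in _ <= X]mulrC -natrM -exprMn.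
apply: le_trans (_ : (_ * (X - 2 * halfwidth p) ^ n)%N%:R <= _); last first.
  rewrite ler_nat; apply: leq_trans (root_count_lb _ p_prime) _.
  by rewrite subnK.
by rewrite natrM natrX natrB // wX mulrBl mul1r.
Qed.

Lemma sum_valuation_mean X M : (0 < X)%N ->
  \sum_(p < M | prime p) valuation_mean p X * ln (p%:R : R) =
  (\sum_(c : {ffun 'I_n -> 'I_X}) \sum_(p < M | prime p)
    (logn p `|nrm k f (belt f Q c)|)%:R * ln (p%:R : R)) / X%:R ^+ n.
Proof.
move=> X0; rewrite exchange_big mulr_suml /=; apply: eq_bigr => p _.
by rewrite /valuation_mean /nrm_valuation natr_sum -mulr_suml mulrAC.
Qed.

(** The mean over the belt of ln |N| = sum of v_p ln p, where every norm is at least X^n. *)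
Lemma mean_log_lb X : (0 < X)%N ->
  n%:R * ln (X%:R : R) <=
  \sum_(p < ((b * X) ^ n).+1 | prime p) valuation_mean p X * ln (p%:R : R).
Proof.
move=> X0; have X0' : 0 < (X%:R : R) by rewrite ltr0n.
rewrite sum_valuation_mean // ler_pdivlMr ?exprn_gt0 //.
have -> : n%:R * ln (X%:R : R) * X%:R ^+ n =
    \sum_(c : {ffun 'I_n -> 'I_X}) ln ((X ^ n)%N%:R : R).
  rewrite sumr_const card_ffun !card_ord -[RHS]mulr_natl natrX lnXn //.
  by rewrite -[ln _ *+ _]mulr_natl mulrC.
apply: ler_sum => c _; rewrite -ln_sum_logn; last first.
  by rewrite absz_gt0 nrm_belt_neq0 //= nrm_belt_ub.
have N0 : (0 < `|nrm k f (belt f Q c)|)%N by rewrite absz_gt0 nrm_belt_neq0.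
by rewrite ler_ln ?posrE ?ltr0n ?expn_gt0 ?X0 // ler_nat nrm_belt_lb.
Qed.

Lemma mean_log_ub X : (0 < X)%N ->
  \sum_(p < ((b * X) ^ n).+1 | prime p) valuation_mean p X * ln (p%:R : R)
  <= n%:R * ln ((b * X)%N%:R : R).
Proof.
move=> X0; have X0' : 0 < (X%:R : R) by rewrite ltr0n.
have bX0 : (0 < b * X)%N by rewrite muln_gt0 X0 andbT /b /belt_bound.
rewrite sum_valuation_mean // ler_pdivrMr ?exprn_gt0 //.
have -> : n%:R * ln ((b * X)%N%:R : R) * X%:R ^+ n =
    \sum_(c : {ffun 'I_n -> 'I_X}) ln (((b * X) ^ n)%N%:R : R).
  rewrite sumr_const card_ffun !card_ord -[RHS]mulr_natl !natrX lnXn ?ltr0n //.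
  by rewrite -[ln _ *+ _]mulr_natl mulrC.
apply: ler_sum => c _; rewrite -ln_sum_logn; last first.
  by rewrite absz_gt0 nrm_belt_neq0 //= nrm_belt_ub.
have N0 : (0 < `|nrm k f (belt f Q c)|)%N by rewrite absz_gt0 nrm_belt_neq0.
by rewrite ler_ln ?posrE ?ltr0n ?expn_gt0 ?bX0 // ler_nat nrm_belt_ub.
Qed.

Let width : R := (2 * (n * entry_bound k f))%N%:R.

Let width_ge0 : 0 <= width. Proof. exact: ler0n. Qed.

Lemma halfwidthE p : (2 * halfwidth p)%:R = width * 2 ^+ up_log (2 ^ n) p.
Proof. by rewrite /width /halfwidth mulnA natrM natrX. Qed.

Let band1 : (1 < 2 ^ n)%N. Proof. by rewrite -{1}(expn0 2) ltn_exp2l. Qed.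

(** From (1+w)^n - 1 + n w <= n ((1+width)^k + 1) w for w <= width, times at most n roots. *)
Let growth_const : R := n%:R * (n%:R * ((1 + width) ^+ k + 1) * width).

(** Both means are compared with #roots/p, using for both boxes the relative widening w of the
    smaller one. *)
Lemma root_mean_growth p a x : prime p -> (p <= (2 ^ x) ^ n)%N ->
  root_mean p (2 ^ (a + x)) <=
  root_mean p (2 ^ x) + growth_const / 2 ^+ x * (2 ^+ up_log (2 ^ n) p / p%:R).
Proof.
move=> p_prime px; have p0 : 0 < (p%:R : R) by rewrite ltr0n prime_gt0.
set i := up_log _ _; pose w : R := width * 2 ^+ i / 2 ^+ x.
have x0 : 0 < (2 ^+ x : R) by exact: exprn_gt0.
have w0 : 0 <= w by rewrite divr_ge0 ?mulr_ge0 ?exprn_ge0.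
have ix : (i <= x)%N by apply: up_log_min => //; rewrite -expnM mulnC expnM.
have wK : w <= width.
  by rewrite /w ler_pdivrMr // ler_wpM2l // ler_eXn2l // ltr1n.
have growth_ge0 : 0 <= growth_const.
  by rewrite !mulr_ge0 // addr_ge0 // exprn_ge0 // addr_ge0.
have [pQ|pQ] := boolP (p %| Q)%N.
  rewrite /root_mean pQ add0r mulr_ge0 ?divr_ge0 ?exprn_ge0 // ltW //.
have ub : root_mean p (2 ^ (a + x)) <=
    #|[pred rho : 'F_p | root (map_poly intr f) rho]|%:R / p%:R * (1 + w) ^+ n.
  apply: root_mean_ub => //; first by rewrite expn_gt0.
  rewrite halfwidthE -/i natrX exprD mulrCA /w divfK ?gt_eqF //.
  by rewrite ler_peMl ?mulr_ge0 ?exprn_ge0 // exprn_ege1 // ler1n.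
have lb : #|[pred rho : 'F_p | root (map_poly intr f) rho]|%:R / p%:R * (1 - n%:R * w) <=
    root_mean p (2 ^ x).
  apply: root_mean_lb => //; first by rewrite expn_gt0.
  by rewrite halfwidthE -/i natrX /w divfK ?gt_eqF.
move: ub lb; set r : R := #|_|%:R => ub lb.
have rn : r <= n%:R by rewrite ler_nat card_roots_le.
apply: le_trans ub _; rewrite -lerBlDl; apply: le_trans (lerB (lexx _) lb) _.
have -> : r / p%:R * (1 + w) ^+ n - r / p%:R * (1 - n%:R * w) =
    r * (((1 + w) ^+ n - 1 + n%:R * w) / p%:R) by ring.
have -> : growth_const / 2 ^+ x * (2 ^+ i / p%:R) =
    n%:R * (n%:R * ((1 + width) ^+ k + 1) * w / p%:R) by rewrite /growth_const /w; ring.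
have in0 : 0 <= (1 + w) ^+ n - 1 + n%:R * w.
  apply: addr_ge0; last exact: mulr_ge0.
  by rewrite subr_ge0 exprn_ege1 // lerDl.
apply: ler_pM => //; first by rewrite divr_ge0 // ltW.
rewrite ler_wpM2r ?invr_ge0 ?(ltW p0) //.
have := expr1D_le k w0; rewrite -/n => e1.
have e2 : (1 + w) ^+ k <= (1 + width) ^+ k.
  by rewrite lerXn2r ?nnegrE ?addr_ge0 // lerD2l.
have nw : 0 <= n%:R * w by rewrite mulr_ge0.
have := ler_wpM2l nw e2; have -> : n%:R * ((1 + width) ^+ k + 1) * w =
  n%:R * w * (1 + width) ^+ k + n%:R * w by ring.
by move=> e3; rewrite lerD2r lerBlDl; apply: le_trans e1 _; rewrite lerD2l.
Qed.

Let large_const : R := n%:R * (1 + width * 2 ^+ b) ^+ n.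

(** Here p may exceed the number of box points, but p^(1/n) is still O(side), since b <= 2^b; the
    mean is therefore O(1/p). *)
Lemma root_mean_large p a x : prime p -> ((2 ^ x) ^ n < p)%N ->
  (p <= (b * 2 ^ (a + x)) ^ n)%N -> root_mean p (2 ^ (a + x)) <= large_const / (2 ^+ x) ^+ n.
Proof.
move=> p_prime xp pb; have p0 : 0 < (p%:R : R) by rewrite ltr0n prime_gt0.
set i := up_log (2 ^ n) p.
have ix : (i <= b + (a + x))%N.
  apply: up_log_min => //; rewrite -expnM mulnC expnM; apply: leq_trans pb _.
  by rewrite leq_exp2r // (expnD 2 b) leq_mul2r ltnW ?orbT // ltn_expl.
have w0 : 0 <= width * 2 ^+ b by rewrite mulr_ge0 // exprn_ge0.
have := @root_mean_ub p (2 ^ (a + x)) (width * 2 ^+ b) p_prime.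
rewrite expn_gt0 => /(_ isT); rewrite halfwidthE -/i natrX -mulrA -exprD => ub.
apply: le_trans (ub _) _; first by rewrite ler_wpM2l // ler_eXn2l // ltr1n.
rewrite /large_const [X in _ <= X]mulrAC ler_wpM2r ?exprn_ge0 ?addr_ge0 //.
apply: ler_pM => //; first by rewrite ler_nat card_roots_le.
rewrite lef_pV2 ?posrE ?exprn_gt0 ?exprn_gt0 //.
by rewrite -!natrX ler_nat ltnW.
Qed.

Definition split_prime p := [&& prime p, ~~ (p %| Q)%N & has_root p].

(* Comparing the mean of ln |N| over boxes of sides 2^x and 2^(a+x): the growth
   n a ln 2 must come from split primes between the two scales. *)
Lemma split_primes_lower_bound : exists c : R, 0 < c /\ exists B : nat, forall x,
  c * (2 ^+ x) ^+ n <= \sum_(p < ((B * 2 ^ x) ^ n).+1 | split_prime p) ln (p%:R : R).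
Proof.
have l4 : 0 <= ln (4%:R : R) by rewrite ln_ge0 // ler1n.
have l2 : 0 < ln (2%:R : R) by rewrite ln_gt0 // ltr1n.
have b0 : (0 < b)%N by rewrite /b /belt_bound.
(* C collects all bounded terms plus 1, and a is chosen so that the growth n a ln 2 exceeds them; a
   surplus of at least 1 is left for the split primes. *)
pose C : R := n%:R * ln (b%:R : R) + growth_const * (2 ^+ n.+1 * ln 4%:R)
  + square_const * (8 * ln 4%:R) + 1.
have nl2 : 0 < n%:R * ln (2%:R : R) by rewrite mulr_gt0.
have [a aC] : exists a : nat, C <= a%:R * (n%:R * ln (2%:R : R)).
  exists (Num.truncn (C / (n%:R * ln 2%:R))).+1.
  by rewrite -ler_pdivrMr // ltW // truncnS_gt.
have large_gt0 : 0 < large_const.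
  by rewrite mulr_gt0 // exprn_gt0 // ltr_pwDl // mulr_ge0 // exprn_ge0.
exists large_const^-1; split; first by rewrite invr_gt0.
exists (b * 2 ^ a)%N => x; rewrite -mulnA -expnD.
set X := (2 ^ x)%N; set Y := (2 ^ (a + x))%N; set M := ((b * Y) ^ n)%N.
have X0 : (0 < X)%N by rewrite expn_gt0.
have Y0 : (0 < Y)%N by rewrite expn_gt0.
have XM : (X ^ n <= M)%N.
  rewrite leq_exp2r //; apply: leq_trans (leq_pmull _ b0).
  by rewrite leq_exp2l // leq_addl.
set theta := \sum_(_ < _ | _) _.
have xn0 : 0 < ((2 ^+ x) ^+ n : R) by rewrite !exprn_gt0.
have main : n%:R * ln (Y%:R : R) <= n%:R * ln ((b * X)%N%:R : R)
    + growth_const * (2 ^+ n.+1 * ln 4%:R) + large_const / (2 ^+ x) ^+ n * theta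
    + square_const * (8 * ln 4%:R).
  apply: le_trans (mean_log_lb Y0) _.
  apply: le_trans (_ : \sum_(p < M.+1 | prime p) root_mean p Y * ln (p%:R : R) +
    square_const * \sum_(p < M.+1 | prime p) ln (p%:R : R) / p%:R ^+ 2 <= _).
    rewrite mulr_sumr -big_split /=; apply: ler_sum => p p_prime.
    have -> : root_mean p Y * ln p%:R + square_const * (ln p%:R / p%:R ^+ 2) =
      (root_mean p Y + square_const / p%:R ^+ 2) * ln p%:R by ring.
    by rewrite ler_wpM2r ?ln_prime_ge0 // valuation_mean_le.
  apply: lerD; last by rewrite ler_wpM2l ?sum_ln_inv_square_le // !mulr_ge0 // exprn_ge0.
  rewrite -(big_mkord prime (fun p => root_mean p Y * ln (p%:R : R))).
  (* Up to X^n the means are passed to the smaller scale, where the total is at most n ln(bX). Above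
     X^n only split primes count, each with mean at most [large_const] / X^n. *)
  rewrite (@big_cat_nat _ _ _ (X ^ n).+1) //=; apply: lerD.
    rewrite big_mkord.
    apply: le_trans (_ : \sum_(p < (X ^ n).+1 | prime p) root_mean p X * ln (p%:R : R) +
      growth_const / 2 ^+ x * \sum_(p < (X ^ n).+1 | prime p)
        ln (p%:R : R) * (2%:R ^+ up_log (2 ^ n) p / p%:R) <= _).
      rewrite mulr_sumr -big_split /=; apply: ler_sum => p p_prime.
      have pX : (p <= X ^ n)%N by rewrite -ltnS.
      set l := ln _; set d := _ / p%:R.
      have -> : root_mean p X * l + growth_const / 2 ^+ x * (l * d) =
        (root_mean p X + growth_const / 2 ^+ x * d) * l by ring.
      by rewrite ler_wpM2r ?ln_prime_ge0 // root_mean_growth.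
    apply: lerD.
      apply: le_trans (mean_log_ub X0).
      have XbX : ((X ^ n).+1 <= ((b * X) ^ n).+1)%N.
        by rewrite ltnS leq_exp2r // leq_pmull.
      rewrite (big_ord_widen_cond _ prime (fun p => root_mean p X * ln (p%:R : R)) XbX).
      rewrite [X in X <= _]big_mkcond [X in _ <= X]big_mkcond; apply: ler_sum => p _ /=.
      case: (boolP (prime p)) => //= p_prime; have l0 := ln_prime_ge0 R p_prime.
      have rv := root_mean_le_valuation_mean X p_prime.
      case: ifP => _; first by rewrite ler_wpM2r.
      by rewrite mulr_ge0 // divr_ge0 // exprn_ge0.
    apply: le_trans (ler_wpM2l _ (sum_ln_root_le R x (ltn0Sn k))) _.
      by rewrite divr_ge0 ?exprn_ge0 // !mulr_ge0 // addr_ge0 // exprn_ge0 // addr_ge0.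
    rewrite le_eqVlt; apply/orP; left; apply/eqP; rewrite -/n; field.
    by rewrite expf_neq0 ?pnatr_eq0.
  rewrite /theta -(big_mkord split_prime (fun p => ln (p%:R : R))).
  rewrite [Z in _ <= _ * Z](@big_cat_nat _ _ _ (X ^ n).+1) //=.
  rewrite mulrDr ler_wpDl //.
    rewrite mulr_ge0 ?divr_ge0 ?(ltW large_gt0) ?(ltW xn0) //.
    by apply: sumr_ge0 => p /andP[p_prime _]; exact: ln_prime_ge0.
  rewrite mulr_sumr [X in X <= _]big_mkcond [X in _ <= X]big_mkcond /=.
  rewrite big_seq [X in _ <= X]big_seq; apply: ler_sum => p; rewrite mem_index_iota ltnS.
  move=> /andP[Xp pM]; rewrite /split_prime.
  case: (boolP (prime p)) => //= p_prime; have l0 := ln_prime_ge0 R p_prime.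
  have [pQ|pQ] /= := boolP (p %| Q)%N; first by rewrite /root_mean pQ mul0r.
  case: ifPn => [_|nr]; last by rewrite root_mean_nonsplit // mul0r.
  by rewrite ler_wpM2r // root_mean_large.
have XR : 0 < (X%:R : R) by rewrite ltr0n.
have bR : 0 < (b%:R : R) by rewrite ltr0n.
have lnY : ln (Y%:R : R) = a%:R * ln 2%:R + ln X%:R.
  rewrite /Y expnD natrM lnM ?posrE ?ltr0n ?expn_gt0 //; congr (_ + _).
  by rewrite natrX lnXn ?ltr0n // mulr_natl.
have lnbX : ln ((b * X)%N%:R : R) = ln b%:R + ln X%:R by rewrite natrM lnM ?posrE.
move: main aC; rewrite lnY lnbX /C => main aC.
have : 1 <= large_const / (2 ^+ x) ^+ n * theta.
  move: main aC; rewrite !mulrDr mulrCA.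
  move: (a%:R * _) (n%:R * ln X%:R) (n%:R * ln b%:R) (growth_const * _) (square_const * _) (_ * theta).
  by move=> u1 u2 u3 u4 u5 u6; lra.
by rewrite mulrAC ler_pdivlMr // mul1r ler_pdivrMl.
Qed.

End SplitPrimes.

(** If all split primes up to M divided u, so would their product, and the sum of their logarithms
    would be at most ln u. M is taken at the least scale that excludes this. *)
Lemma small_split_prime (R : realType) (f : {poly int}) (Q0 : nat) :
  f \is monic -> (1 < size f)%N -> coprime_below f -> (0 < Q0)%N ->
  exists K : R, 1 <= K /\ forall u : nat, (0 < u)%N ->
    exists p, [/\ prime p, (2 < p)%N, ~~ (p %| Q0)%N, has_root f p
      & ~~ (p %| u)%N /\ p%:R <= K * (ln (u%:R : R) + 1)].
Proof.
move=> f_monic f1 f_min Q0_gt0; set k := (size f).-2; set n := k.+1.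
have sf : size f = k.+2 by rewrite /k; case: (size f) f1 => [|[]].
have sf' : (size f^`() < size f)%N by rewrite lt_size_deriv ?monic_neq0.
have f'0 : f^`() != 0.
  apply/eqP => /polyP/(_ k); rewrite coef_deriv coef0 -[f`_k.+1]/(f`_k.+2.-1) -sf.
  by rewrite -lead_coefE (monicP f_monic) => /eqP; rewrite pnatr_eq0.
have [u0 [v0 [w [w0 uvw]]]] := f_min _ f'0 sf'.
(* The constant w of the Bezout identity between f and its derivative covers the primes where f is
   not squarefree; the factorial covers those up to 2n. *)
pose Q := (Q0 * `|w| * (2 * n)`!)%N.
have Q_gt0 : (0 < Q)%N by rewrite !muln_gt0 Q0_gt0 absz_gt0 w0 fact_gt0.
have Qdvd p : prime p -> ~~ (p %| Q)%N ->
    [/\ ~~ (p %| Q0)%N, ~~ (p %| `|w|)%N & (2 * n < p)%N].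
  move=> p_prime; rewrite /Q 2?Euclid_dvdM // !negb_or => /andP[/andP[-> ->] pf].
  split => //; rewrite ltnNge; apply: contra pf => pn.
  by rewrite dvdn_fact // prime_gt0.
have Q_spec p : prime p -> ~~ (p %| Q)%N -> (2 * k.+1 <= p)%N /\
    coprimep (map_poly intr f : {poly 'F_p}) (map_poly intr f)^`().
  move=> p_prime /(Qdvd _ p_prime)[_ pw pn]; split; first exact: ltnW.
  have wp : w%:~R != 0 :> 'F_p by rewrite Fp_intr_eq0.
  apply/Bezout_eq1_coprimepP.
  exists ((w%:~R)^-1 *: map_poly intr v0, (w%:~R)^-1 *: map_poly intr u0) => /=.
  rewrite deriv_map -!scalerAl -scalerDr -!rmorphM -rmorphD addrC uvw /= map_polyC /=.
  by rewrite -mul_polyC -polyCM mulVf.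
have [c [c0 [B cB]]] := split_primes_lower_bound R f_monic sf f_min Q_gt0 Q_spec.
(* For the least admissible x, (2^x)^n <= 2^n ln u / c + 1, where the 1 covers x = 0; this gets
   multiplied by B^n. *)
pose K : R := B%:R ^+ n * (2 ^+ n / c) + B%:R ^+ n + 1.
have Bn0 : 0 <= (B%:R : R) ^+ n by rewrite exprn_ge0.
have K0 : 0 <= B%:R ^+ n * (2 ^+ n / c) :> R.
  by rewrite mulr_ge0 // divr_ge0 ?exprn_ge0 // ltW.
exists K; split; first by rewrite lerDr addr_ge0.
move=> u u_gt0; have lu : 0 <= ln (u%:R : R) by rewrite ln_ge0 // ler1n.
have exx : exists x, ln (u%:R : R) < c * (2 ^+ x) ^+ n.
  exists (Num.truncn (ln (u%:R : R) / c)).+1; set y := (Num.truncn _).+1.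
  rewrite mulrC -ltr_pdivrMr //; apply: lt_le_trans (truncnS_gt _) _.
  rewrite -/y -!natrX ler_nat; apply: (@leq_trans (2 ^ y)%N); first by rewrite ltnW // ltn_expl.
  by rewrite -expnM leq_exp2l // leq_pmulr.
case: (ex_minnP exx) => x xu xmin.
have Kx : ((B * 2 ^ x) ^ n)%N%:R <= K * (ln (u%:R : R) + 1).
  have xn : (2 ^+ x) ^+ n <= 2 ^+ n / c * ln (u%:R : R) + 1.
    case: x xu xmin => [|x] xu xmin.
      by rewrite expr0 expr1n lerDr mulr_ge0 // divr_ge0 ?exprn_ge0 // ltW.
    have : c * (2 ^+ x) ^+ n <= ln (u%:R : R).
      by rewrite leNgt; apply/negP => /xmin; rewrite ltnn.
    rewrite mulrC -ler_pdivlMr // => le; rewrite exprS exprMn ler_wpDr //.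
    by rewrite -mulrA [c^-1 * _]mulrC ler_wpM2l // exprn_ge0.
  rewrite natrX natrM natrX exprMn; apply: le_trans (ler_wpM2l Bn0 xn) _.
  rewrite /K; move: (2 ^+ n / c) Bn0 K0 lu => q.
  move: (B%:R ^+ n) (ln u%:R) => z l z0 zq0 l0.
  have zl : 0 <= z * l by exact: mulr_ge0.
  rewrite -subr_ge0; set d := _ - _.
  have -> : d = z * q + z * l + l + 1 by rewrite /d; ring.
  by rewrite !addr_ge0.
pose M := ((B * 2 ^ x) ^ n)%N.
have [p [sp pM pu]] : exists p, [/\ split_prime f Q p, (p <= M)%N & ~~ (p %| u)%N].
  apply: contrapT => none; have := cB x; rewrite leNgt => /negP; apply.
  apply: le_lt_trans xu; pose s := [seq p <- iota 0 M.+1 | split_prime f Q p].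
  have -> : \sum_(p < M.+1 | split_prime f Q p) ln (p%:R : R) = \sum_(p <- s) ln p%:R.
    by rewrite big_filter -(big_mkord (split_prime f Q) (fun p => ln (p%:R : R))) /index_iota subn0.
  have s_prime : all prime s.
    by apply/allP => p; rewrite mem_filter => /andP[/and3P[]].
  have su : (\prod_(p <- s) p %| u)%N.
    apply: dvdn_prod_primes; rewrite ?filter_uniq ?iota_uniq // => p.
    rewrite mem_filter mem_iota add0n ltnS => /andP[sp /andP[_ pM]].
    by apply/negPn/negP => pu; apply: none; exists p.
  have [pos <-] : (0 < \prod_(p <- s) p)%N /\
      ln ((\prod_(p <- s) p)%N%:R : R) = \sum_(p <- s) ln p%:R.
    elim: s s_prime {su} => [|p s IH] /=; first by rewrite !big_nil ln1.
    move=> /andP[p_prime /IH[s0 e]]; rewrite !big_cons muln_gt0 prime_gt0 // s0.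
    by split; rewrite // -e natrM lnM ?posrE ?ltr0n ?(prime_gt0 p_prime).
  by rewrite ler_ln ?posrE ?ltr0n // ler_nat dvdn_leq.
move: sp => /and3P[p_prime pQ rt]; have [pQ0 _ pn] := Qdvd _ p_prime pQ.
exists p; split => //; first by apply: leq_ltn_trans pn; rewrite /n mulnS leq_addr.
by split => //; apply: le_trans Kx; rewrite ler_nat.
Qed.

(** * Finite quotients of G_phi *)

Local Open Scope classical_set_scope.
Local Open Scope card_scope.
Local Open Scope ring_scope.

(** The key need not be constant on cosets nor a homomorphism, which permits keys built from chosen
    representatives. *)
Lemma index_le_card (G : groupType) (N : set G) (F : finType) (key : G -> F) :
  subgroup N -> (forall x y, key x = key y -> N (x^-1 * y)%g) ->
  exists2 k, has_index N k & (k <= #|F|)%N.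
Proof.
move=> [N1 NM NV] keyN.
pose coset (x : G) : set G := [set (x * h)%g | h in N].
have cosetE x y : key x = key y -> coset x = coset y.
  move=> xy; apply/seteqP; split=> z [h Nh <-].
    exists (y^-1 * x * h)%g; last by rewrite mulgA mulgA mulgV mul1g.
    by apply: NM => //; apply: keyN.
  exists (x^-1 * y * h)%g; last by rewrite mulgA mulgA mulgV mul1g.
  by apply: NM => //; apply: keyN.
have le : lcosets N #<= `I_#|F|.
  pose pick (i : nat) : G := xget 1%g [set x | enum_rank (key x) = i :> nat].
  apply: card_le_trans (card_image_le (coset \o pick) `I_#|F|).
  apply: subset_card_le => _ [x _ <-]; exists (enum_rank (key x) : nat) => //=.
  apply: cosetE; apply: enum_rank_inj; apply: val_inj.
  have : [set y | enum_rank (key y) = enum_rank (key x) :> nat] x by [].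
  by move=> /(xgetI 1%g) /= ->.
have /finite_setP[k ik] : finite_set (lcosets N) by apply/finite_set_leP; exists #|F|.
exists k => //; rewrite -card_le_II; apply: card_le_trans le.
by move: ik; rewrite card_eq_le => /andP[].
Qed.

(** * Growth of coordinates along words *)

Section WordGrowth.
Variables (m n : nat) (phi : {bilinear 'cV[int]_m -> 'cV[int]_m -> 'cV[int]_n}).

Definition phiL_bound : nat :=
  \sum_(i < n) \sum_(j < m) \sum_(l < m) `|formmxL phi i j l|%N.

Lemma phiL_le (w w' : 'cV[int]_m) (A B : nat) i :
  (forall j, `|w j 0%R| <= A)%N -> (forall j, `|w' j 0%R| <= B)%N ->
  (`|phiL phi w w' i 0%R| <= phiL_bound * A * B)%N.
Proof.
move=> wA wB; rewrite phiLE -lez_nat abszE mxE.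
apply: le_trans (_ : (\sum_(l < m) \sum_(j < m) `|formmxL phi i j l|%N * A * B)%N%:Z <= _).
  rewrite (big_morph Posz PoszD (erefl 0%:Z)).
  apply: le_trans (ler_norm_sum _ _ _) _; apply: ler_sum => l _.
  rewrite mxE mulr_suml (big_morph Posz PoszD (erefl 0%:Z)).
  apply: le_trans (ler_norm_sum _ _ _) _; apply: ler_sum => j _.
  have -> : w^T ord0 j = w j 0 by rewrite mxE.
  rewrite !normrM -!abszE -!PoszM lez_nat; apply: leq_mul; last exact: wB.
  by rewrite mulnC leq_mul.
rewrite exchange_big /= lez_nat /phiL_bound.
rewrite (bigD1 i) //= !mulnDl -!mulnA; apply: leq_trans (leq_addr _ _).
rewrite big_distrl /=; apply: leq_sum => j _; rewrite big_distrl /=.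
by apply: leq_sum => l _; rewrite mulnA.
Qed.

Definition coordinates_le (g : Gphi phi) (A B : nat) : Prop :=
  (forall j, `|g.1 j 0%R| <= A)%N /\ (forall i, `|g.2 i 0%R| <= B)%N.

Lemma finite_coordinates_le (S : set (Gphi phi)) : finite_set S ->
  exists M : nat, forall x, S x \/ S (x^-1)%g -> coordinates_le x M M.
Proof.
move=> /finite_seqP[s ->].
pose h (x : Gphi phi) : nat :=
  ((\sum_j `|x.1 j 0%R|) + (\sum_i `|x.2 i 0%R|))%N.
have hP x M : (h x <= M)%N -> coordinates_le x M M.
  move=> hM; split=> j; apply: leq_trans hM; rewrite /h (bigD1 j) //=.
    by rewrite -addnA leq_addr.
  by rewrite addnCA leq_addr.
exists (\max_(x <- s) maxn (h x) (h x^-1%g)) => x xs; apply: hP.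
case: xs => /= xs.
  by apply: leq_trans (leq_bigmax_seq _ xs isT); rewrite leq_maxl.
by apply: leq_trans (leq_bigmax_seq _ xs isT); rewrite invgK leq_maxr.
Qed.

(** The first component grows linearly, so each further letter adds a linear amount to the second,
    which grows quadratically. The induction keeps the linear bound; the statement weakens it to a
    common one. *)
Lemma word_coordinates_le (S : set (Gphi phi)) : finite_set S ->
  exists K : nat, forall w : seq (Gphi phi),
    (forall x, x \in w -> S x \/ S (x^-1)%g) ->
    coordinates_le (\prod_(x <- w) x)%g (K * size w ^ 2) (K * size w ^ 2).
Proof.
move=> /finite_coordinates_le[M MS]; pose K := (M + phiL_bound * M * M)%N.
exists K => w wS.
suff [h1 h2] : coordinates_le (\prod_(x <- w) x)%g (M * size w) (K * size w ^ 2).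
  split=> // j; apply: leq_trans (h1 j) _; rewrite leq_mul ?leq_addr //.
  by case: (size w) => // l; rewrite expnS leq_pmulr // expn_gt0.
elim: w wS => [|x w IH] wS.
  by rewrite big_nil; split=> j; rewrite mxE.
have [x1 x2] : coordinates_le x M M by apply: MS; apply: wS; rewrite mem_head.
have [|w1 w2] := IH; first by move=> y yw; apply: wS; rewrite inE yw orbT.
rewrite big_cons; set g := (\prod_(y <- w) y)%g in w1 w2 *.
rewrite -[(x * g)%g]/(Gphi_mul x g); split=> j /=.
  rewrite mxE mulnS; move: (x1 j) (w1 j); move: (x.1 j 0%R) (g.1 j 0%R) (M * size w)%N.
  by move=> a c d; lia.
rewrite mxE mxE; have := phiL_le j x1 w1.
move: (x2 j) (w2 j); move: (x.2 j 0%R) (g.2 j 0%R) (phiL _ _ _ _ _) => a c d.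
have -> : (K * (size w).+1 ^ 2 = K * size w ^ 2 + (M + phiL_bound * M * (M * size w))
  + (M * (2 * size w) + phiL_bound * M * M * (1 + size w)))%N by rewrite /K; ring.
move: (K * size w ^ 2)%N (phiL_bound * M * (M * size w))%N.
by move: (M * (2 * size w) + _)%N => A B C; lia.
Qed.

End WordGrowth.

(** * Normal subgroups of small index avoiding an element *)

Section CongruenceQuotients.
Variables (m n : nat) (phi : {bilinear 'cV[int]_m -> 'cV[int]_m -> 'cV[int]_n}).
Hypothesis phi_alt : alternating phi.

Lemma phi_diag w : phi w w = 0.
Proof.
apply/colP => i; have := congr1 (fun v : 'cV[int]_n => v i 0) (phi_alt w w).
by rewrite !mxE; move: (phi w w i 0) => a; lia.
Qed.

Lemma phiL_sub w w' : phiL phi w w' - phiL phi w' w = phi w w'.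
Proof.
have skew i j l : formmx phi i j l = - formmx phi i l j.
  by rewrite !mxE (phi_alt (delta_mx l 0)) mxE opprK.
rewrite phi_formmxE; apply/colP => i.
rewrite [RHS]mxE [LHS]mxE [X in _ + X]mxE !phiLE.
have -> : (w'^T *m formmxL phi i *m w) 0 0 = (w^T *m (formmxL phi i)^T *m w') 0 0.
  have tr (M : 'M[int]_1) : M 0 0 = M^T 0 0 by rewrite mxE.
  by rewrite [LHS]tr !trmx_mul trmxK mulmxA.
have -> : formmx phi i = formmxL phi i - (formmxL phi i)^T.
  apply/matrixP => j l; rewrite [RHS]mxE [X in _ = _ + X]mxE [X in _ = _ - X]mxE.
  rewrite [X in _ = X - _]mxE [X in _ = _ - X]mxE.
  case: (ltngtP l j) => [_|_|/val_inj ->]; first by rewrite subr0.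
    by rewrite sub0r skew.
  by rewrite subrr; have := skew i j j; move: (formmx phi i j j) => a; lia.
by rewrite mulmxBr mulmxBl [RHS]mxE [X in _ = _ + X]mxE.
Qed.

Definition detects (g : Gphi phi) (k : nat) : Prop :=
  exists N : set (Gphi phi), [/\ normal_subgroup N, ~ N g & has_index N k].

Lemma detect_nonabelian_part p (g : Gphi phi) j : prime p ->
  ~~ (p %| `|g.1 j 0%R|)%N -> exists2 k, detects g k & (k <= p)%N.
Proof.
move=> p_prime pg; pose key (x : Gphi phi) : 'F_p := (x.1 j 0)%:~R.
pose N : set (Gphi phi) := [set x | key x = 0].
have keyM x y : key (x * y)%g = key x + key y.
  by rewrite /key -[(x * y)%g]/(Gphi_mul x y) /= mxE rmorphD.
have keyV x : key (x^-1)%g = - key x.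
  by rewrite /key -[(x^-1)%g]/(Gphi_inv x) /= mxE rmorphN.
have key1 : key 1%g = 0 by rewrite /key mxE.
have sN : subgroup N.
  split=> [//|x y|x]; rewrite /N /= ?keyM ?keyV; first by move=> -> ->; rewrite addr0.
  by move=> ->; rewrite oppr0.
have [|k ik kp] := index_le_card (key := key) sN.
  by move=> x y e; rewrite /N /= keyM keyV e addNr.
exists k; last by rewrite card_Fp in kp.
exists N; split => //.
  by split=> // x y; rewrite /N /= conjgE !keyM keyV => ->; rewrite add0r addNr.
by rewrite /N /key /= => /eqP; rewrite Fp_intr_eq0 // (negPf pg).
Qed.

(* Inside the preimage of radical x F_p, chi is a homomorphism onto F_p (p is
   odd), and its kernel N is normal and meets the center where a.v = 0. *)
Lemma detect_central_part p d (g : Gphi phi) i : prime p -> (2 < p)%N ->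
  rank_certificate d (formmx phi) 'F_p -> g.1 = 0 ->
  ~~ (p %| `|g.2 i 0%R|)%N -> exists2 k, detects g k & (k <= p ^ d.+1)%N.
Proof.
move=> p_prime p2 [b [b' [l [u [bb' lu]]]]] g1 pg.
pose red q (v : 'cV[int]_q) : 'cV['F_p]_q := map_mx intr v.
have redD q (v w : 'cV[int]_q) : red q (v + w) = red q v + red q w by exact: map_mxD.
have redN q (v : 'cV[int]_q) : red q (- v) = - red q v by exact: map_mxN.
have red0 q : red q 0 = 0 by exact: map_mx0.
(* b is invertible, so a vector that is nonzero mod p pairs nontrivially with some column a of b. *)
have [j vj] : exists j, \sum_i b i j * red _ g.2 i 0 != 0.
  apply: contrapT => none.
  have vb : (red _ g.2)^T *m b = 0.
    apply/rowP => j; rewrite !mxE; apply/eqP/negPn/negP => nz; apply: none.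
    exists j; apply: contraNneq nz => e; rewrite -[X in _ == X]e; apply/eqP.
    by apply: eq_bigr => x _; rewrite !mxE mulrC.
  have : (red _ g.2)^T = 0 by rewrite -[LHS]mulmx1 -bb' mulmxA vb mul0mx.
  move=> /rowP/(_ i); rewrite !mxE => /eqP.
  by rewrite Fp_intr_eq0 // (negPf pg).
pose fa (v : 'cV[int]_n) : 'F_p := \sum_i b i j * red _ v i 0.
have faD v w : fa (v + w) = fa v + fa w.
  by rewrite /fa redD -big_split; apply: eq_bigr => x _; rewrite mxE mulrDr.
have fa0 : fa 0 = 0 by apply: big1 => x _; rewrite red0 mxE mulr0.
have faN v : fa (- v) = - fa v by apply: (addIr (fa v)); rewrite -faD !addNr fa0.
have beta_l w w' : u j *m red _ w' = 0 -> fa (phi w w') = 0.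
  move=> uw'; have -> : fa (phi w w') =
      ((red _ w)^T *m (\sum_x b x j *: map_mx intr (formmx phi x)) *m red _ w') 0 0.
    rewrite mulmx_sumr mulmx_suml summxE; apply: eq_bigr => x _.
    rewrite -scalemxAr -scalemxAl [RHS]mxE; congr (_ * _).
    by rewrite phi_formmxE /red map_trmx -!map_mxM [RHS]mxE [LHS]mxE [in LHS]mxE.
  by rewrite lu -!mulmxA uw' !mulmx0 mxE.
have beta_r w w' : u j *m red _ w = 0 -> fa (phi w w') = 0.
  by move=> uw; rewrite phi_alt faN beta_l // oppr0.
(* The quadratic term symmetrizes the cocycle: the failure of additivity becomes the alternating
   form a.phi, which vanishes as soon as u_j kills one argument. The factor 2 avoids a division by
   2. *)
pose chi (x : Gphi phi) : 'F_p := 2%:R * fa x.2 - fa (phiL phi x.1 x.1).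
have chiM x y : chi (x * y)%g = chi x + chi y + fa (phi x.1 y.1).
  rewrite -[(x * y)%g]/(Gphi_mul x y) /chi /= -phiL_sub phiLDl !phiLDr !faD faN.
  by ring.
have chi1 : chi 1%g = 0 by rewrite /chi /= phiL0l !fa0 mulr0 subr0.
have uM (x y : Gphi phi) :
    u j *m red _ ((x * y)%g : Gphi phi).1 = u j *m red _ x.1 + u j *m red _ y.1.
  by rewrite -[(x * y)%g]/(Gphi_mul x y) /= redD mulmxDr.
have uV (x : Gphi phi) : u j *m red _ ((x^-1)%g : Gphi phi).1 = - (u j *m red _ x.1).
  by rewrite -[(x^-1)%g]/(Gphi_inv x) /= redN mulmxN.
have chiV x : chi (x^-1)%g = - chi x.
  apply: (addIr (chi x)); rewrite addNr -chi1 -(mulVg x) chiM.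
  by rewrite -[((x^-1)%g : Gphi phi).1]/(- x.1) linearNl phi_diag oppr0 fa0 addr0.
pose N : set (Gphi phi) := [set x | u j *m red _ x.1 = 0 /\ chi x = 0].
have sN : subgroup N.
  split=> [|x y [ux cx] [uy cy]|x [ux cx]]; rewrite /N /=.
  - by rewrite red0 mulmx0.
  - by rewrite uM ux uy addr0 chiM cx cy beta_l // !addr0.
  - by rewrite uV ux chiV cx !oppr0.
(* A representative over each value of u_j w; the default 1 is never reached, as s is only applied
   to attained values. Since chi is additive only up to the form, the key records chi relative to
   this representative. *)
pose s y : Gphi phi := xget 1%g [set x : Gphi phi | u j *m red _ x.1 = y].
have sP (x : Gphi phi) : u j *m red _ (s (u j *m red _ x.1)).1 = u j *m red _ x.1.
  exact: (@xgetI _ 1%g [set y : Gphi phi | u j *m red _ y.1 = u j *m red _ x.1] x).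
pose key (x : Gphi phi) : 'cV['F_p]_d * 'F_p :=
  (u j *m red _ x.1, chi ((s (u j *m red _ x.1))^-1 * x)%g).
have [|k ik kp] := index_le_card (key := key) sN.
  move=> x y e; have uxy : u j *m red _ x.1 = u j *m red _ y.1 := congr1 fst e.
  have cxy : chi ((s (u j *m red _ x.1))^-1 * x)%g =
    chi ((s (u j *m red _ y.1))^-1 * y)%g := congr1 snd e.
  rewrite -uxy in cxy; have sx := sP x; set t := s _ in sx cxy.
  have -> : (x^-1 * y = (t^-1 * x)^-1 * (t^-1 * y))%g.
    by rewrite invgM invgK -mulgA (mulgA t) mulgV mul1g.
  have ux' : u j *m red _ ((t^-1 * x)%g : Gphi phi).1 = 0 by rewrite uM uV sx addNr.
  have uy' : u j *m red _ ((t^-1 * y)%g : Gphi phi).1 = 0 by rewrite uM uV sx -uxy addNr.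
  split; first by rewrite uM uV ux' uy' oppr0 addr0.
  by rewrite chiM chiV cxy addNr add0r beta_l.
exists k; last first.
  by move: kp; rewrite card_prod card_mx card_Fp // muln1 -expnSr.
exists N; split => //.
  split=> // x y [ux cx]; rewrite conjgE; split.
    by rewrite !uM uV ux add0r addNr.
  rewrite !chiM chiV cx add0r (beta_r x.1) // addr0 addNr add0r.
  rewrite -[((y^-1)%g : Gphi phi).1]/(- y.1) -[((x * y)%g : Gphi phi).1]/(x.1 + y.1).
  by rewrite linearNl linearDr /= phi_diag addr0 faN beta_l ?oppr0.
(* On the central g, chi is 2 a.v, nonzero because p is odd. *)
move=> [_]; rewrite /chi g1 phiL0l fa0 subr0 => /eqP; rewrite mulf_eq0 (negPf vj) orbF.
rewrite -(dvdn_pcharf (pchar_Fp p_prime)) => /(dvdn_leq (isT : (0 < 2)%N)).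
by rewrite leqNgt p2.
Qed.

End CongruenceQuotients.

(** * The growth bound *)

Lemma rank_factorization (F : fieldType) m d (A : 'M[F]_m) : (\rank A <= d)%N ->
  exists (l : 'M[F]_(m, d)) (u : 'M[F]_(d, m)), A = l *m u.
Proof.
move=> rd; exists (col_ebase A *m pid_mx (\rank A)), (pid_mx (\rank A) *m row_ebase A).
rewrite -mulmxA (mulmxA (pid_mx _)) mul_pid_mx minnn (minn_idPr rd) mulmxA.
by rewrite mulmx_ebase.
Qed.

Lemma dphi_certificate (R : realType) m n
    (phi : {bilinear 'cV[int]_m -> 'cV[int]_m -> 'cV[int]_n}) :
  rank_certificate (dphi phi R) (formmx phi) (complex R).
Proof.
rewrite /dphi; case: ex_minnP => d /asboolP[X X_basis dE] _.
have X_free := basis_free X_basis.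
have sX : size X = n.
  by move: X_free; rewrite /free (span_basis X_basis) dimvf => /eqP <-; exact: muln1.
pose b : 'M[complex R]_n := \matrix_(i, j) X`_j i 0.
have b_unit : b \in unitmx.
  rewrite -unitmx_tr -row_free_unit; apply: inj_row_free => v vb.
  have sum0 : \sum_(i < n) v 0 i *: X`_i = 0.
    apply/colP => i; have /rowP/(_ i) := vb; rewrite !mxE summxE => e.
    by rewrite -[RHS]e; apply: eq_bigr => j _; rewrite !mxE.
  have t : size X == n by rewrite sX.
  apply/rowP => i; rewrite mxE.
  exact: (elimT (@freeP _ _ n (Tuple t)) X_free (fun i => v 0 i) sum0 i).
have lu j : exists lu : 'M[complex R]_(m, d) * 'M[complex R]_(d, m),
    \sum_i b i j *: map_mx intr (formmx phi i) = lu.1 *m lu.2.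
  have [|l [u e]] := @rank_factorization _ m d (comb phi (X`_j)).
    by rewrite dE (big_rem X`_j) ?mem_nth ?sX //= leq_maxl.
  exists (l, u); rewrite -e; apply: eq_bigr => i _; by rewrite mxE.
have [g gE] := choice lu.
exists b, (invmx b), (fun j => (g j).1), (fun j => (g j).2); split => //.
by rewrite mulmxV.
Qed.

Theorem theorem3p9 (R : realType) (m n : nat) (hm : (0 < m)%N) (hn : (0 < n)%N)
    (phi : {bilinear 'cV[int]_m -> 'cV[int]_m -> 'cV[int]_n})
    (phi_alt : alternating phi) (phi_full : full phi)
    (S : set (Gphi phi)) (S_fin : finite_set S)
    (S_gen : generated S = [set: Gphi phi]) :
  preceq (RF R S) (log_pow R ((dphi phi R).+1)).
Proof.
set d := dphi phi R.
have [b [b' [l [u certC]]]] := dphi_certificate R phi.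
have [A [io [s [ks lift]]]] := exists_specialization
  (certificate_entries b b' l u) (pchar_num algC).
have cert_algC : rank_certificate d (formmx phi) algC.
  apply: (rank_certificate_transfer (D := 1) ks _ certC).
    by rewrite rmorph1 oner_neq0.
  by move=> x /lift[a <-]; exists a; rewrite rmorph1 mul1r.
have [f [Q [f_monic f1 f_min Q_gt0 certp]]] := finite_field_certificate cert_algC.
have [K [K1 small]] := small_split_prime R f_monic f1 f_min Q_gt0.
have [B0 word] := word_coordinates_le S_fin.
(* A coordinate is at most B (2r)^2 = 4 B r^2, with logarithm at most L + 2 ln r, and L + 2 ln r + 1
   <= (3 + L) (ln r + 1). *)
pose B := B0.+1; pose L : R := ln (4 * B)%N%:R.
have L0 : 0 <= L by rewrite ln_ge0 // ler1n.
pose K' : R := K * (3 + L).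
have K0 : 0 < K by apply: lt_le_trans K1.
have K'1 : 1 <= K' by rewrite mulr_ege1 // ler_wpDr // ler1n.
(* C >= e gives ln r + 1 <= ln (C r), which also covers r = 1; the other term absorbs the constant
   of p^(d+1). *)
pose C : R := Num.max (expR 1) (K' ^+ d.+1).
have C_ge : expR 1 <= C /\ K' ^+ d.+1 <= C by rewrite /C !le_max !lexx orbT.
have C0 : 0 < C by apply: lt_le_trans (proj1 C_ge); exact: expR_gt0.
exists C; split => // r; rewrite ge_max => /andP[r1 _].
have r0 : 0 < r by apply: lt_le_trans r1.
have lr : 0 <= ln r by rewrite ln_ge0.
apply: ge_ereal_sup => _ [g [g1 gr] <-].
suff [k gk kle] : exists2 k, detects g k & k%:R <= (K' * (ln r + 1)) ^+ d.+1.
  apply: (@le_trans _ _ (k%:R)%:E).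
    by apply: ereal_inf_lbound; exists k.
  rewrite /log_pow -EFinM lee_fin; apply: le_trans kle _; rewrite exprMn.
  apply: ler_pM; rewrite ?exprn_ge0 ?addr_ge0 //; first by apply: le_trans K'1.
    exact: (proj2 C_ge).
  rewrite lerXn2r ?nnegrE ?addr_ge0 //.
    rewrite lnM ?posrE //; apply: addr_ge0 => //; rewrite ln_ge0 //.
    by apply: le_trans (proj1 C_ge); rewrite -expR0 ler_expR.
  rewrite lnM ?posrE // addrC lerD2r -[X in X <= _](expRK 1).
  by rewrite ler_ln ?posrE ?expR_gt0 // (proj1 C_ge).
(* An infimum at most r provides a word of length below r + 1 <= 2r, so attainment of the norm need
   not be discussed. *)
have [w [wS wg wr]] : exists w : seq (Gphi phi),
    [/\ forall x, x \in w -> S x \/ S (x^-1)%g, (\prod_(x <- w) x)%g = g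
      & (size w)%:R <= 2 * r].
  have : (word_norm R S g < (r + 1)%:E)%E.
    by apply: le_lt_trans gr _; rewrite lte_fin ltrDl.
  move=> /ereal_inf_lt[_ [_ [w [wS wg] <-] <-]]; rewrite lte_fin => wr.
  exists w; split; [exact: wS | exact: wg |].
  by apply: le_trans (ltW wr) _; rewrite mulr_natl mulr2n lerD2l.
have [le1 le2] := word w wS; rewrite wg in le1 le2.
have detect_prime (c : int) : c != 0 -> (`|c| <= B0 * size w ^ 2)%N ->
    exists p, [/\ prime p, (2 < p)%N, rank_certificate d (formmx phi) 'F_p,
      ~~ (p %| `|c|)%N & p%:R <= K' * (ln r + 1)].
  move=> c0 cB; have c_gt0 : (0 < `|c|)%N by rewrite absz_gt0.
  have [p [p_prime p2 pQ /existsP[rho rt] [pc pK]]] := small `|c|%N c_gt0.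
  exists p; split => //; first exact: certp rt.
  apply: le_trans pK _; rewrite /K' -mulrA ler_wpM2l ?(ltW K0) //.
  have lc : ln (`|c|%N%:R : R) <= L + 2 * ln r.
    have -> : L + 2 * ln r = ln ((4 * B)%N%:R * r ^+ 2).
      by rewrite lnM ?posrE ?exprn_gt0 ?ltr0n // lnXn // mulr_natl.
    rewrite ler_ln ?posrE ?ltr0n ?mulr_gt0 ?exprn_gt0 ?ltr0n //.
    apply: le_trans (_ : (B * size w ^ 2)%N%:R <= _).
      by rewrite ler_nat (leq_trans cB) // leq_mul2r leqnSn orbT.
    rewrite (natrM _ B) natrX (natrM _ 4) [4%:R * _]mulrC -mulrA ler_wpM2l //.
    have -> : 4%:R * r ^+ 2 = (2 * r) ^+ 2 by ring.
    by rewrite lerXn2r ?nnegrE // mulr_ge0 // ltW.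
  apply: le_trans (lerD lc (lexx 1)) _; rewrite -subr_ge0.
  have -> : (3 + L) * (ln r + 1) - (L + 2 * ln r + 1) = ln r + L * ln r + 2 by ring.
  by rewrite !addr_ge0 // mulr_ge0.
have powle p : prime p -> p%:R <= K' * (ln r + 1) ->
    ((p ^ d.+1)%N%:R : R) <= (K' * (ln r + 1)) ^+ d.+1.
  by move=> p_prime pK; rewrite natrX lerXn2r ?nnegrE // (le_trans _ pK).
have [g10|] := eqVneq g.1 0; last first.
  move=> g10; have [j gj] : exists j, g.1 j 0 != 0.
    apply: contrapT => none; move/eqP: g10; apply; apply/colP => j; rewrite mxE.
    by apply/eqP/negPn/negP => gj; apply: none; exists j.
  have [p [p_prime p2 _ pg pK]] := detect_prime _ gj (le1 j).
  have [k gk kp] := detect_nonabelian_part p_prime pg.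
  exists k => //; apply: le_trans (powle _ p_prime pK).
  by rewrite ler_nat (leq_trans kp) // expnS leq_pmulr // expn_gt0 prime_gt0.
have [i gi] : exists i, g.2 i 0 != 0.
  apply: contrapT => none; apply: g1; rewrite [g]surjective_pairing g10.
  congr pair; apply/colP => i; rewrite mxE.
  by apply/eqP/negPn/negP => gi; apply: none; exists i.
have [p [p_prime p2 cert pg pK]] := detect_prime _ gi (le2 i).
have [k gk kp] := detect_central_part phi_alt p_prime p2 cert g10 pg.
by exists k => //; apply: le_trans (powle _ p_prime pK); rewrite ler_nat.
Qed.
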